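(* Let $0<m<\infty$, let $\zeta\in\mathbb{C}^m$, and let $E,F$ be complex Banach spaces. Then every $\mathcal{O}_\zeta$-module homomorphism $\mathcal{O}^E_\zeta\rightarrow\mathcal{O}^F_\zeta$ is plain, i.e., it is induced by a germ $\Phi\in\mathcal{O}^{\mathrm{Hom}(E,F)}_\zeta$.
   Context: All Banach spaces are over $\mathbb{C}$. $\mathrm{Hom}(E,F)$ is the Banach space of continuous linear operators $E\to F$ with the operator norm. $\mathcal{O}^E_\zeta$ denotes the set of germs at $\zeta$ of holomorphic functions defined near $\zeta$ in $\mathbb{C}^m$ with values in $E$; $\mathcal{O}_\zeta=\mathcal{O}^{\mathbb{C}}_\zeta$ is the local ring of scalar holomorphic germs, and $\mathcal{O}^E_\zeta$ is an $\mathcal{O}_\zeta$-module (a ''plain module''). Homomorphisms are purely algebraic (no continuity assumed). A germ $\Phi\in\mathcal{O}^{\mathrm{Hom}(E,F)}_\zeta$ induces an $\mathcal{O}_\zeta$-homomorphism $\mathcal{O}^E_\zeta\to\mathcal{O}^F_\zeta$ sending the germ of $e$ to the germ of $z\mapsto\Phi(z)e(z)$; homomorphisms obtained in this way are called plain. *)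

(* Defs.v *)
From HB Require Import structures.
From mathcomp Require Import all_boot all_order all_algebra.
From mathcomp Require Import generic_quotient.
From mathcomp Require Import all_classical all_reals all_analysis.
From mathcomp Require Import complex.

Set Implicit Arguments.
Unset Strict Implicit.
Unset Printing Implicit Defensive.

Import Order.TTheory GRing.Theory Num.Theory.
Import numFieldNormedType.Exports.

Local Open Scope classical_set_scope.
Local Open Scope quotient_scope.
Local Open Scope complex_scope.
Local Open Scope ring_scope.

Section ContinuousLinear.
Variables (R : realType) (E F : normedModType R[i]).

Definition clinear : {pred E -> F} :=
  [pred f : E -> F | `[< linear f /\ continuous f >]].

Lemma clinearP (f : E -> F) : f \in clinear <-> linear f /\ continuous f.
Proof. by split=> [/asboolP|?]; last apply/asboolP. Qed.

Lemma clinear_submod : submod_closed clinear.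
Proof.
split=> [|a f g]; rewrite ?clinearP.
  split; first by move=> k x y; rewrite /= scaler0 addr0.
  exact: cst_continuous.
move=> [lf cf] [lg cg]; split.
  move=> k x y; rewrite -[LHS]/(a *: f (k *: x + y) + g (k *: x + y)).
  rewrite -[RHS]/(k *: (a *: f x + g x) + (a *: f y + g y)).
  by rewrite lf lg !scalerDr !scalerA mulrC addrACA.
by move=> x; apply: cvgD; [apply: cvgZl_tmp; exact: cf|exact: cg].
Qed.

HB.instance Definition _ :=
  GRing.isSubmodClosed.Build R[i] (E -> F) clinear clinear_submod.

Record CHom : Type := MkCHom { chom_fun :> E -> F; _ : chom_fun \in clinear }.

HB.instance Definition _ := [isSub for chom_fun].
HB.instance Definition _ := [Choice of CHom by <:].
HB.instance Definition _ := [SubChoice_isSubLmodule of CHom by <:].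

Lemma chom_linear (f : CHom) : linear f.
Proof. by case: f => f /= /clinearP[]. Qed.

HB.instance Definition _ (f : CHom) :=
  GRing.isLinear.Build R[i] E F _ (chom_fun f) (chom_linear f).

Lemma chom_continuous (f : CHom) : continuous f.
Proof. by case: f => f /= /clinearP[]. Qed.

Lemma normE (G : normedModType R[i]) (x : G) : `|x| = (complex.Re `|x|)%:C.
Proof. by rewrite RRe_real ?normr_real. Qed.

(* Norms are R[i]-valued; the supremum has to be taken in R. *)
Definition opnorm (f : CHom) : R[i] :=
  (sup [set complex.Re `|f x| | x in [set x : E | `|x| <= 1]])%:C.

Lemma chom_bounded (f : CHom) :
  has_sup [set complex.Re `|f x| | x in [set x : E | `|x| <= 1]].
Proof.
split; first by exists (complex.Re `|f 0|), 0 => //=; rewrite normr0 ler01.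
have /linear_boundedP/pinfty_ex_gt0[r r0 fr] :=
  continuous_linear_bounded (0 : E) (@chom_continuous f 0).
exists (complex.Re r) => _ [x /= x1 <-].
rewrite -lecR -normE RRe_real ?gtr0_real//.
by rewrite (le_trans (fr x))// ler_piMr// ltW.
Qed.

Lemma opnorm_ub (f : CHom) (x : E) : `|f x| <= opnorm f * `|x|.
Proof.
have [->|x0] := eqVneq x 0; first by rewrite linear0 !normr0 mulr0.
have nx : 0 < `|x| by rewrite normr_gt0.
rewrite -ler_pdivrMr// mulrC.
have -> : `|x|^-1 * `|f x| = `|f (`|x|^-1 *: x)|.
  by rewrite linearZ/= normrZ normfV normr_id.
rewrite normE lecR; apply: ub_le_sup; first exact: (chom_bounded f).2.
by exists (`|x|^-1 *: x) => //=; rewrite normrZ normfV normr_id mulVf// gt_eqF.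
Qed.

Lemma opnorm_le (f : CHom) (M : R[i]) : 0 <= M ->
  (forall x, `|f x| <= M * `|x|) -> opnorm f <= M.
Proof.
move=> M0 fM; rewrite -(RRe_real (ger0_real M0)) lecR.
apply: ge_sup; first exact: (chom_bounded f).1.
move=> _ [x /= x1 <-]; rewrite -lecR -normE RRe_real ?ger0_real//.
by rewrite (le_trans (fM x))// ler_piMr.
Qed.

Lemma opnorm_ge0 (f : CHom) : 0 <= opnorm f.
Proof.
rewrite lecR; apply: ub_le_sup; first exact: (chom_bounded f).2.
by exists 0; rewrite /= ?linear0 normr0// ler01.
Qed.

Lemma opnormD (f g : CHom) : opnorm (f + g) <= opnorm f + opnorm g.
Proof.
apply: opnorm_le; first by rewrite addr_ge0 ?opnorm_ge0.
by move=> x; rewrite mulrDl (le_trans (ler_normD _ _))// lerD ?opnorm_ub.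
Qed.

Lemma opnormZ (a : R[i]) (f : CHom) : opnorm (a *: f) = `|a| * opnorm f.
Proof.
apply/le_anti/andP; split.
  apply: opnorm_le; first by rewrite mulr_ge0 ?opnorm_ge0.
  move=> x; rewrite -[(a *: f : CHom) x]/(a *: f x) normrZ -mulrA.
  by rewrite ler_wpM2l ?opnorm_ub.
have [->|a0] := eqVneq a 0; first by rewrite normr0 mul0r opnorm_ge0.
have na : 0 < `|a| by rewrite normr_gt0.
rewrite mulrC -ler_pdivlMr//; apply: opnorm_le.
  by rewrite divr_ge0 ?opnorm_ge0.
move=> x; rewrite mulrAC ler_pdivlMr// mulrC -normrZ.
exact: (opnorm_ub (a *: f)).
Qed.

Lemma opnorm_eq0 (f : CHom) : opnorm f = 0 -> f = 0.
Proof.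
move=> f0; apply/val_inj/funext => x; apply/normr0_eq0/le_anti.
by rewrite normr_ge0 andbT (le_trans (opnorm_ub f x))// f0 mul0r.
Qed.

HB.instance Definition _ :=
  Lmodule_isNormed.Build R[i] CHom opnormD opnormZ opnorm_eq0.

Lemma chom_normE (f : CHom) : `|f| = opnorm f. Proof. by []. Qed.

End ContinuousLinear.

Section CHomApp.
Variables (R : realType) (E F : normedModType R[i]).

Definition chom_app (f : CHom E F) (x : E) : F := f x.

Lemma chom_app_bilinear : bilinear_for *:%R *:%R chom_app.
Proof.
split=> [x a f g|f a x y]; first by [].
by rewrite /chom_app linearP.
Qed.

HB.instance Definition _ :=
  bilinear_isBilinear.Build R[i] (CHom E F) E F _ _ chom_app chom_app_bilinear.

Lemma chom_app_continuous : continuous (fun p : CHom E F * E => chom_app p.1 p.2).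
Proof.
move=> [/= k x]; apply/cvgrPdist_lt => _/posnumP[e]; near +oo_R[i] => M.
near=> l z => /=; have M0 : 0 < M by [].
rewrite (@distm_lt_split _ _ (chom_app k z)) // -?(linearBr, linearBl).
  rewrite (le_lt_trans (opnorm_ub k _))// -chom_normE.
  rewrite (@le_lt_trans _ _ (M * `|x - z|)) ?ler_wpM2r -?ltr_pdivlMl//.
  by near: z; apply: cvgr_dist_lt; rewrite // mulr_gt0 ?invr_gt0.
rewrite (le_lt_trans (opnorm_ub (k - l) _))// -chom_normE.
rewrite (@le_lt_trans _ _ (`|k - l| * M)) ?ler_wpM2l -?ltr_pdivlMr//.
  by near: z; near: M; apply: cvg_bounded (@cvg_refl _ _).
by near: l; apply: cvgr_dist_lt; rewrite // divr_gt0.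
Unshelve. all: by end_near. Qed.

End CHomApp.

Section Germ.
Variables (R : realType) (V : normedModType R[i]) (zeta : V).
Implicit Types E F G : normedModType R[i].

(* A function holomorphic near zeta, extended arbitrarily to the whole space:
   germ equality only sees its values near zeta. Holomorphy on an open set is
   complex Frechet differentiability at each of its points. *)
Record holo E : Type := Holo {
  holo_fun :> V -> E;
  holo_near : \forall z \near zeta, differentiable holo_fun z }.

HB.instance Definition _ E := gen_eqMixin (holo E).
HB.instance Definition _ E := gen_choiceMixin (holo E).

Definition germ_eq E : rel (holo E) :=
  fun f g => `[< \forall z \near zeta, f z = g z >].

Lemma germ_eq_equiv E : equiv_class_of (@germ_eq E).
Proof.
split=> [f|f g|g f h].
- by apply/asboolP; apply: nearW.
- by apply/asboolP/asboolP; apply: filterS => z ->.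
- move=> /asboolP fg /asboolP gh; apply/asboolP.
  by apply: filterS2 fg gh => z -> ->.
Qed.

Canonical germ_equiv E := EquivRelPack (germ_eq_equiv E).

Definition germ E := {eq_quot @germ_eq E}.

HB.instance Definition _ E := Choice.on (germ E).

Definition germ_of E (f : holo E) : germ E := \pi f.

Lemma germ_ofP E (f g : holo E) :
  germ_of f = germ_of g <-> \forall z \near zeta, f z = g z.
Proof. by split=> [/eqmodP/asboolP|fg]; last exact/eqmodP/asboolP. Qed.

Lemma germ_ofK E (x : germ E) : germ_of (repr x) = x.
Proof. exact: reprK. Qed.

Lemma repr_germ_of E (f : holo E) : \forall z \near zeta, repr (germ_of f) z = f z.
Proof. by apply/germ_ofP; rewrite germ_ofK. Qed.

Lemma holo_cst_near E (c : E) :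
  \forall z \near zeta, differentiable (cst c : V -> E) z.
Proof. by apply: nearW => z; exact: differentiable_cst. Qed.

Lemma holo_opp_near E (f : holo E) :
  \forall z \near zeta, differentiable (fun z => - f z) z.
Proof. by apply: filterS (holo_near f) => z; exact: differentiableN. Qed.

Lemma holo_add_near E (f g : holo E) :
  \forall z \near zeta, differentiable (fun z => f z + g z) z.
Proof.
by apply: filterS2 (holo_near f) (holo_near g) => z; exact: differentiableD.
Qed.

Lemma holo_bilin_near E F G (b : {bilinear E -> F -> G}) (f : holo E) (g : holo F) :
  continuous (fun p => b p.1 p.2) ->
  \forall z \near zeta, differentiable (fun z => b (f z) (g z)) z.
Proof.
move=> bc; apply: filterS2 (holo_near f) (holo_near g) => z df dg.
apply: (@differentiable_comp _ _ _ _ (fun z => (f z, g z))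
  (fun p => b p.1 p.2)); first exact: differentiable_pair.
exact: differentiable_bilin.
Qed.

Lemma holo_scale_near E (a : holo R[i]^o) (f : holo E) :
  \forall z \near zeta, differentiable (fun z => (a z : R[i]) *: f z) z.
Proof.
have bl : bilinear_for *:%R *:%R (fun (a : R[i]^o) (x : E) => (a : R[i]) *: x).
  split=> [x k u v|u k x y] /=; first by rewrite scalerDl scalerA.
  by rewrite scalerDr !scalerA mulrC.
pose B := bilinear_isBilinear.Build R[i] R[i]^o E E _ _ _ bl.
pose b : {bilinear R[i]^o -> E -> E} := HB.pack (fun (a : R[i]^o) (x : E) => (a : R[i]) *: x) B.
exact: (holo_bilin_near (b := b) a f (@scale_continuous _ _)).
Qed.

(* R[i]^o is R[i] as a normed space over itself, so germ R[i]^o is the local ring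
   of scalar germs; its product is germ_scale at E = R[i]^o. *)
Definition germ0 E : germ E := germ_of (Holo (holo_cst_near 0)).
Definition germ_opp E (x : germ E) : germ E :=
  germ_of (Holo (holo_opp_near (repr x))).
Definition germ_add E (x y : germ E) : germ E :=
  germ_of (Holo (holo_add_near (repr x) (repr y))).
Definition germ_scale E (a : germ R[i]^o) (x : germ E) : germ E :=
  germ_of (Holo (holo_scale_near (repr a) (repr x))).
Definition germ1 : germ R[i]^o := germ_of (Holo (holo_cst_near (1 : R[i]^o))).

Lemma germ_eqP E (x y : germ E) :
  (\forall z \near zeta, repr x z = repr y z) -> x = y.
Proof. by move=> /germ_ofP; rewrite !germ_ofK. Qed.

Lemma germ0E E : \forall z \near zeta, repr (germ0 E) z = 0.
Proof. exact: repr_germ_of. Qed.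

Lemma germ1E : \forall z \near zeta, repr germ1 z = 1.
Proof. exact: repr_germ_of. Qed.

Lemma germ_oppE E (x : germ E) :
  \forall z \near zeta, repr (germ_opp x) z = - repr x z.
Proof. exact: repr_germ_of. Qed.

Lemma germ_addE E (x y : germ E) :
  \forall z \near zeta, repr (germ_add x y) z = repr x z + repr y z.
Proof. exact: repr_germ_of. Qed.

Lemma germ_scaleE E (a : germ R[i]^o) (x : germ E) :
  \forall z \near zeta, repr (germ_scale a x) z = (repr a z : R[i]) *: repr x z.
Proof. exact: repr_germ_of. Qed.

Lemma germ_addA E : associative (@germ_add E).
Proof.
move=> x y w; apply: germ_eqP; near=> z.
rewrite (near (germ_addE x (germ_add y w)) z)//.
rewrite (near (germ_addE (germ_add x y) w) z)//.
by rewrite (near (germ_addE y w) z)// (near (germ_addE x y) z)// addrA.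
Unshelve. all: by end_near. Qed.

Lemma germ_addC E : commutative (@germ_add E).
Proof.
move=> x y; apply: germ_eqP.
by apply: filterS2 (germ_addE x y) (germ_addE y x) => z -> ->; rewrite addrC.
Qed.

Lemma germ_add0 E : left_id (germ0 E) (@germ_add E).
Proof.
move=> x; apply: germ_eqP.
by apply: filterS2 (germ_addE (germ0 E) x) (germ0E E) => z -> ->; rewrite add0r.
Qed.

Lemma germ_addN E : left_inverse (germ0 E) (@germ_opp E) (@germ_add E).
Proof.
move=> x; apply: germ_eqP.
apply: filterS3 (germ_addE (germ_opp x) x) (germ_oppE x) (germ0E E).
by move=> z -> -> ->; rewrite addNr.
Qed.

HB.instance Definition _ E := GRing.isZmodule.Build (germ E)
  (@germ_addA E) (@germ_addC E) (@germ_add0 E) (@germ_addN E).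

Lemma germ_scaleA E (a b : germ R[i]^o) (x : germ E) :
  germ_scale a (germ_scale b x) = germ_scale (germ_scale a b) x.
Proof.
apply: germ_eqP; near=> z.
rewrite (near (germ_scaleE a (germ_scale b x)) z)//.
rewrite (near (germ_scaleE (germ_scale a b) x) z)//.
rewrite (near (germ_scaleE b x) z)// (near (germ_scaleE a b) z)//.
by rewrite scalerA.
Unshelve. all: by end_near. Qed.

Lemma germ_scale1 E : left_id germ1 (@germ_scale E).
Proof.
move=> x; apply: germ_eqP.
by apply: filterS2 (germ_scaleE germ1 x) germ1E => z -> ->; rewrite scale1r.
Qed.

Lemma germ_scaleDr E : right_distributive (@germ_scale E) +%R.
Proof.
move=> a x y; apply: germ_eqP; near=> z.
rewrite (near (germ_scaleE a (x + y)) z)// (near (germ_addE x y) z)//.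
rewrite (near (germ_addE (germ_scale a x) (germ_scale a y)) z)//.
by rewrite (near (germ_scaleE a x) z)// (near (germ_scaleE a y) z)// scalerDr.
Unshelve. all: by end_near. Qed.

Lemma germ_scaleDl E (x : germ E) (a b : germ R[i]^o) :
  germ_scale (a + b) x = germ_scale a x + germ_scale b x.
Proof.
apply: germ_eqP; near=> z.
rewrite (near (germ_scaleE (a + b) x) z)// (near (germ_addE a b) z)//.
rewrite (near (germ_addE (germ_scale a x) (germ_scale b x)) z)//.
by rewrite (near (germ_scaleE a x) z)// (near (germ_scaleE b x) z)// scalerDl.
Unshelve. all: by end_near. Qed.

Lemma germ_mulC : commutative (@germ_scale R[i]^o).
Proof.
move=> a b; apply: germ_eqP.
apply: filterS2 (germ_scaleE a b) (germ_scaleE b a) => z -> ->.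
exact: mulrC.
Qed.

Lemma germ1_neq0 : germ1 != 0.
Proof.
apply/eqP => /germ_ofP /nbhs_singleton /= /eqP.
by rewrite oner_eq0.
Qed.

HB.instance Definition _ := GRing.Zmodule_isComNzRing.Build (germ R[i]^o)
  (@germ_scaleA R[i]^o) germ_mulC (@germ_scale1 R[i]^o)
  (fun a b x => germ_scaleDl x a b) germ1_neq0.

HB.instance Definition _ E :=
  GRing.Zmodule_isLmodule.Build (germ R[i]^o) (germ E)
    (@germ_scaleA E) (@germ_scale1 E) (@germ_scaleDr E) (@germ_scaleDl E).

Lemma holo_app_near E F (Phi : holo (CHom E F)) (f : holo E) :
  \forall z \near zeta, differentiable (fun z => Phi z (f z)) z.
Proof.
exact: (holo_bilin_near (b := @chom_app R E F) Phi f (@chom_app_continuous R E F)).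
Qed.

Definition plain_map E F (Phi : germ (CHom E F)) (x : germ E) : germ F :=
  germ_of (Holo (holo_app_near (repr Phi) (repr x))).

Lemma plain_map_germ_of E F (Phi : holo (CHom E F)) (f : holo E) :
  plain_map (germ_of Phi) (germ_of f) = germ_of (Holo (holo_app_near Phi f)).
Proof.
apply/germ_ofP; apply: filterS2 (repr_germ_of Phi) (repr_germ_of f).
by move=> z /= -> ->.
Qed.

Lemma plain_mapE E F (Phi : germ (CHom E F)) (x : germ E) :
  \forall z \near zeta, repr (plain_map Phi x) z = repr Phi z (repr x z).
Proof. exact: repr_germ_of. Qed.

Lemma plain_map_linear E F (Phi : germ (CHom E F)) : linear (plain_map Phi).
Proof.
move=> a x y; apply: germ_eqP; near=> z.
rewrite (near (plain_mapE Phi (a *: x + y)) z)//.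
rewrite (near (germ_addE (a *: x) y) z)// (near (germ_scaleE a x) z)//.
rewrite (near (germ_addE (a *: plain_map Phi x) (plain_map Phi y)) z)//.
rewrite (near (germ_scaleE a (plain_map Phi x)) z)//.
by rewrite (near (plain_mapE Phi x) z)// (near (plain_mapE Phi y) z)// linearP.
Unshelve. all: by end_near. Qed.

End Germ.

(* Main.v *)
(* Write T x for the image of the constant germ x, and let c_j(T x; v) be the j-th
   Taylor coefficient of T x along the line zeta + t v.  Applying T to
   sum_n (z_i - zeta_i)^n x_n, with (x_n) bounded, gives a germ whose coefficients
   sum_n v_i^n c_{k-n}(T x_n; v) grow at most exponentially; a gliding hump then
   shows that every x |-> c_j(T x; v) is continuous, and Baire's theorem that
   |c_j(T x; v)| <= K N^j |x| uniformly in v.  Hence Phi(z) x = sum_j c_j(T x; z - zeta)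
   is a germ of Hom(E, F), and T - Phi kills the constants.  By Hadamard's lemma
   e = e(zeta) + sum_i (z_i - zeta_i) g_i, so T - Phi raises the order of vanishing
   arbitrarily, hence is 0.

   The holomorphic functions of the statement are merely complex differentiable and
   Banach valued.  Their Taylor theory is obtained without integrals: Goursat's
   bisection applies to trapezoid sums, which are exact on affine functions, and
   pulling back by the exponential turns circles into segments. *)
Require Import Defs.
From HB Require Import structures.
From mathcomp Require Import all_boot all_order all_algebra.
From mathcomp Require Import all_classical all_reals all_analysis.
From mathcomp Require Import complex.
From mathcomp Require Import ring lra zify.
Import Order.TTheory GRing.Theory Num.Theory.
Import numFieldNormedType.Exports.
Local Open Scope classical_set_scope.
Local Open Scope complex_scope.
Local Open Scope ring_scope.
Set Implicit Arguments.
Unset Strict Implicit.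
Unset Printing Implicit Defensive.

(** * Real-valued norms *)

(** No continuity of [T] is given, so [T] cannot be applied to a series term by term. Instead, each
    coefficient is blind to high powers: writing the series as x_0 + (z_i - zeta_i) e' and
    iterating, one finds that the k-th coefficient of its image involves only x_0, ..., x_k. The
    image is nevertheless a germ, and testing its exponential growth against all bounded sequences
    yields continuity of the coefficient maps. This needs some v_i to be nonzero, hence a positive
    dimension: for m = 0 every linear map from E to F would be a homomorphism. Continuity has to
    precede Baire's theorem, because it makes the sets there closed. On the analytic side nearly
    everything rests on the second-order bound [taylor2], whose constant depends only on a radius
    and a bound of the function. It gives limits of holomorphic functions, holomorphy of
    derivatives, and the passage from pointwise to norm holomorphy of [Phi]. It comes from the mean
    value property of difference quotients, which is therefore proved for functions assumed only
    continuous at the centre. *)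

Definition nm (R : rcfType) (G : normedZmodType R[i]) (x : G) : R :=
  complex.Re `|x|.

Section Norm.
Variables (R : rcfType) (G : normedZmodType R[i]).
Implicit Types x y : G.

Lemma nmE x : `|x| = (nm x)%:C.
Proof. by rewrite RRe_real ?normr_real. Qed.

Lemma nm_ge0 x : 0 <= nm x.
Proof. by rewrite -lecR -nmE normr_ge0. Qed.

Lemma nm0 : nm (0 : G) = 0.
Proof. by rewrite /nm normr0. Qed.

Lemma nm_eq0 x : nm x = 0 -> x = 0.
Proof. by move=> x0; apply/normr0_eq0; rewrite nmE x0. Qed.

Lemma nmN x : nm (- x) = nm x.
Proof. by rewrite /nm normrN. Qed.

Lemma nmBC x y : nm (x - y) = nm (y - x).
Proof. by rewrite /nm distrC. Qed.

Lemma nmD x y : nm (x + y) <= nm x + nm y.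
Proof. by rewrite -lecR rmorphD /= -!nmE ler_normD. Qed.

Lemma nmB x y : nm (x - y) <= nm x + nm y.
Proof. by rewrite -(nmN y) nmD. Qed.

Lemma nm_sum n (u : nat -> G) :
  nm (\sum_(0 <= i < n) u i) <= \sum_(0 <= i < n) nm (u i).
Proof.
elim: n => [|n IH]; first by rewrite !big_nil nm0.
by rewrite !big_nat_recr //=; apply: le_trans (nmD _ _) _; rewrite lerD2r.
Qed.

Lemma nm_small x : (forall e, 0 < e -> nm x <= e) -> x = 0.
Proof.
move=> xe; apply/nm_eq0/le_anti; rewrite nm_ge0 andbT.
by apply/ler_addgt0Pl => e e0; rewrite addr0 xe.
Qed.

End Norm.

Section NormScale.
Variable R : realType.

Lemma nmZ (G : normedModType R[i]) (a : R[i]) (x : G) :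
  nm (a *: x) = nm a * nm x.
Proof. by apply: complexI; rewrite rmorphM /= -!nmE normrZ. Qed.

Lemma nmM (a b : R[i]) : nm (a * b) = nm a * nm b.
Proof. by apply: complexI; rewrite rmorphM /= -!nmE normrM. Qed.

Lemma nm1 : nm (1 : R[i]) = 1.
Proof. by apply: complexI; rewrite -nmE normr1. Qed.

Lemma nmX (a : R[i]) n : nm (a ^+ n) = nm a ^+ n.
Proof. by apply: complexI; rewrite rmorphXn /= -!nmE normrX. Qed.

Lemma nmV (a : R[i]) : nm a^-1 = (nm a)^-1.
Proof. by apply: complexI; rewrite fmorphV /= -!nmE normfV. Qed.

Lemma nmR (r : R) : nm (r%:C : R[i]) = `|r|.
Proof. by apply: complexI; rewrite -nmE normc_def /= expr0n addr0 sqrtr_sqr. Qed.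

Lemma nm_gt0 (a : R[i]) : a != 0 -> 0 < nm a.
Proof.
by move=> a0; rewrite lt_neqAle nm_ge0 andbT eq_sym; apply: contra_neq a0 => /nm_eq0.
Qed.

End NormScale.

(* Locked: unifying ['d f a] with ['d f b] would compare neighbourhood filters. *)
HB.lock Definition dd (R : realType) (V F : normedModType R[i]) (f : V -> F)
  (a : V) : V -> F := 'd f a.

Lemma dd_linear (R : realType) (V F : normedModType R[i]) (f : V -> F) (a : V) :
  linear (dd f a).
Proof. by rewrite dd.unlock; exact: linearP. Qed.

HB.instance Definition _ (R : realType) (V F : normedModType R[i]) (f : V -> F)
  (a : V) := GRing.isLinear.Build R[i] V F _ (dd f a) (dd_linear f a).

(** * Differentiability in real epsilon-delta form *)

Section Interface.
Variables (R : realType) (V F : normedModType R[i]).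

Lemma near_nmP (a : V) (P : V -> Prop) :
  (\forall z \near a, P z) <->
  exists2 r : R, 0 < r & forall z, nm (z - a) < r -> P z.
Proof.
rewrite nbhs_normP; split=> [[/= e e0 eP]|[r r0 rP]].
  exists (complex.Re e); first by rewrite -ltcR RRe_real// gtr0_real.
  move=> z za; apply: eP => /=; rewrite distrC nmE -(RRe_real (gtr0_real e0)).
  by rewrite ltcR.
exists r%:C; first by rewrite /= ltcR.
by move=> z /=; rewrite distrC nmE ltcR; exact: rP.
Qed.

Lemma nm_leM (x : V) (y : F) (r : R) : (nm y <= r * nm x) = (`|y| <= r%:C * `|x|).
Proof. by rewrite !nmE -rmorphM lecR. Qed.

Lemma diff_approx (f : V -> F) a : differentiable f a ->
  forall e : R, 0 < e -> exists2 d : R, 0 < d &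
  forall h, nm h < d -> nm (f (a + h) - f a - dd f a h) <= e * nm h.
Proof.
rewrite dd.unlock; move=> /diff_locally /eqaddoP df e e0.
have := df e%:C; rewrite ltcR => /(_ e0) /near_nmP[d d0 dP]; exists d => // h hd.
have := dP h; rewrite subr0 => /(_ hd) /=.
rewrite -[X in `|X|]/(f (h + a) - (f a + 'd f a h)) opprD addrA addrC (addrC h).
by rewrite -nm_leM addrC.
Qed.

Lemma diff_bounded (f : V -> F) a : differentiable f a ->
  exists2 C : R, 0 <= C & forall h, nm (dd f a h) <= C * nm h.
Proof.
rewrite dd.unlock; move=> df; have dc : continuous ('d f a) by exact: diff_continuous.
have /linear_boundedP/pinfty_ex_gt0[r r0 fr] :=
  continuous_linear_bounded (0 : V) (dc 0).
exists (complex.Re r); first by rewrite -lecR RRe_real ?gtr0_real ?ltW.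
by move=> h; rewrite nm_leM RRe_real ?gtr0_real.
Qed.

(** The bound [C] makes [L] continuous, as a differential must be; uniqueness of the differential
    then identifies it with [dd f a]. *)
Lemma diff_intro (f : V -> F) a (L : V -> F) (C : R) : linear L ->
  (forall h, nm (L h) <= C * nm h) ->
  (forall e : R, 0 < e -> exists2 d : R, 0 < d &
    forall h, nm h < d -> nm (f (a + h) - f a - L h) <= e * nm h) ->
  differentiable f a /\ dd f a = L.
Proof.
rewrite dd.unlock; move=> lL LC fL.
pose M := GRing.isLinear.Build R[i] V F _ L lL.
pose L' : {linear V -> F} := HB.pack L M.
have cL : continuous L'.
  apply/linear_bounded_continuous/linear_boundedP.
  exists (C%:C); split; first by rewrite realE !lecR -realE num_real.
  move=> y Cy x; apply: le_trans (_ : C%:C * `|x| <= _).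
    by rewrite -nm_leM LC.
  by rewrite ler_wpM2r // ltW.
have fo : f \o shift a = cst (f a) + L' +o_ 0 id.
  apply/eqaddoP => e e0; apply/near_nmP.
  have [|d d0 dP] := fL (complex.Re e).
    by rewrite -ltcR RRe_real// gtr0_real.
  exists d => // h; rewrite subr0 => hd; have := dP h hd.
  rewrite -[(_ - _) h]/(f (h + a) - (f a + L h)) opprD addrA addrC (addrC h).
  by rewrite nm_leM RRe_real ?gtr0_real // addrC.
have dL := diff_unique cL fo; split; last by rewrite dL.
by apply/diff_locallyP; rewrite dL.
Qed.

End Interface.

Section Complete.
Variables (R : realType) (F : completeNormedModType R[i]).

Lemma cauchy_lim (u : nat -> F) :
  (forall e : R, 0 < e -> exists n0, forall n k, (n0 <= n)%N -> (n0 <= k)%N ->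
     nm (u n - u k) <= e) ->
  exists l, forall e : R, 0 < e -> exists n0, forall n, (n0 <= n)%N ->
    nm (u n - l) <= e.
Proof.
move=> uc; have cu : cvg (u @ \oo).
  apply/cauchy_cvgP/cauchy_exP => e e0.
  pose e' := complex.Re e.
  have e'0 : 0 < e' by rewrite -ltcR RRe_real// gtr0_real.
  have [n0 un0] := uc (e' / 2) ltac:(by rewrite divr_gt0).
  exists (u n0); exists n0 => // n /= n0n.
  rewrite -ball_normE /= -(RRe_real (gtr0_real e0)) nmE ltcR.
  by apply: le_lt_trans (un0 n0 n _ _) _ => //; rewrite -/e' ltr_pdivrMr ?ltr_pMr ?ltr1n.
exists (lim (u @ \oo)) => e e0.
have /cvgrPdist_le/(_ e%:C) := cu; rewrite ltcR => /(_ e0) [n0 _ nP].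
exists n0 => n n0n; rewrite nmBC -lecR -nmE; exact: nP.
Qed.

End Complete.

(** * Goursat's lemma for trapezoid sums *)

(* A reflexive decision procedure for identities in a module: both sides are
   reified and compared coefficient by coefficient in the scalar ring. *)
Section ModuleTactic.
Variables (K : comNzRingType) (V : lmodType K).

Inductive mexp :=
  | MVar of nat | MZero | MAdd of mexp & mexp | MOpp of mexp
  | MScale of K & mexp.

Fixpoint meval (l : seq V) e : V :=
  match e with
  | MVar n => nth 0 l n
  | MZero => 0
  | MAdd e1 e2 => meval l e1 + meval l e2
  | MOpp e1 => - meval l e1
  | MScale a e1 => a *: meval l e1
  end.

(** Indices are compared with [PeanoNat.Nat.eqb] so that [cbv], given a short list of constants,
    reduces the coefficients to plain ring expressions for [ring] or [field]. *)
Fixpoint mcoef e (n : nat) : K :=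
  match e with
  | MVar k => if PeanoNat.Nat.eqb k n then 1 else 0
  | MZero => 0
  | MAdd e1 e2 => mcoef e1 n + mcoef e2 n
  | MOpp e1 => - mcoef e1 n
  | MScale a e1 => a * mcoef e1 n
  end.

Lemma mevalE l e : meval l e = \sum_(i < size l) mcoef e i *: nth 0 l i.
Proof.
elim: e => [n||e1 IH1 e2 IH2|e1 IH1|a e1 IH1] /=.
- have eqbE k : PeanoNat.Nat.eqb n k = (n == k) :> bool.
    by apply/idP/eqP => [/PeanoNat.Nat.eqb_eq|/PeanoNat.Nat.eqb_eq].
  have [ln|nl] := ltnP n (size l).
    rewrite (bigD1 (Ordinal ln)) //= eqbE eqxx scale1r big1 ?addr0 // => i.
    by rewrite -val_eqE /= eqbE eq_sym => /negPf ->; rewrite scale0r.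
  rewrite nth_default // big1 // => i _.
  by rewrite eqbE gtn_eqF ?scale0r // (leq_trans (ltn_ord i)).
- by rewrite big1 // => i _; rewrite scale0r.
- by rewrite IH1 IH2 -big_split; apply: eq_bigr => i _; rewrite scalerDl.
- by rewrite IH1 -sumrN; apply: eq_bigr => i _; rewrite scaleNr.
- by rewrite IH1 scaler_sumr; apply: eq_bigr => i _; rewrite scalerA.
Qed.

Fixpoint mcoef_eq e1 e2 n : Prop :=
  if n is k.+1 then mcoef e1 k = mcoef e2 k /\ mcoef_eq e1 e2 k else True.

Lemma meval_eq l e1 e2 : mcoef_eq e1 e2 (size l) -> meval l e1 = meval l e2.
Proof.
move=> eq12; rewrite !mevalE; apply: eq_bigr => i _; congr (_ *: _).
elim: (size l) eq12 (nat_of_ord i) (ltn_ord i) => [//|n IH] /= [en eq12] k.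
by rewrite ltnS leq_eqVlt => /orP[/eqP ->//|]; apply: IH.
Qed.

End ModuleTactic.

Ltac mod_index x l :=
  match l with
  | cons ?y _ => let _ := match goal with _ => unify x y end in constr:(O)
  | cons _ ?r => let n := mod_index x r in constr:(S n)
  end.
Ltac mod_insert x l :=
  match l with
  | _ => let _ := mod_index x l in l
  | nil => constr:(cons x l)
  | cons ?y ?r => let r' := mod_insert x r in constr:(cons y r')
  end.
Ltac mod_atoms t l :=
  lazymatch t with
  | (?x + ?y)%R => let l1 := mod_atoms x l in mod_atoms y l1
  | (- ?x)%R => mod_atoms x l
  | (_ *: ?x)%R => mod_atoms x l
  | 0%R => l
  | _ => mod_insert t l
  end.
Ltac mod_reify K t l :=
  lazymatch t with
  | (?x + ?y)%R => let e1 := mod_reify K x l in let e2 := mod_reify K y l in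
                   constr:(@MAdd K e1 e2)
  | (- ?x)%R => let e1 := mod_reify K x l in constr:(@MOpp K e1)
  | (?a *: ?x)%R => let e1 := mod_reify K x l in constr:(@MScale K a e1)
  | 0%R => constr:(@MZero K)
  | _ => let n := mod_index t l in constr:(@MVar K n)
  end.
Ltac mod_eq_with K :=
  lazymatch goal with
  | |- @eq ?T ?x ?y =>
    let l0 := mod_atoms x (@nil T) in let l := mod_atoms y l0 in
    let e1 := mod_reify K x l in let e2 := mod_reify K y l in
    refine (@meval_eq K _ l e1 e2 _);
    cbv [mcoef_eq mcoef size PeanoNat.Nat.eqb]; repeat split
  end.
Tactic Notation "mod_eq" constr(K) := mod_eq_with K; (ring || field).

Section Bisection.
Variable R : realType.

Lemma pow2V_lt (e : R) : 0 < e -> exists K, forall k, (K <= k)%N -> 2^-1 ^+ k < e.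
Proof.
move=> e0; pose K := Num.truncn e^-1; exists K => k Kk.
rewrite exprVn invf_plt ?posrE ?exprn_gt0 //.
have : e^-1 < K.+1%:R by rewrite truncnS_gt.
move=> /lt_le_trans; apply; rewrite -natrX ler_nat.
by apply: leq_ltn_trans Kk _; apply: ltn_expl.
Qed.

Lemma nested_point (u : nat -> R) :
  (forall k, u k <= u k.+1 <= u k + 2^-1 ^+ k.+1) ->
  exists x, forall k, u k <= x <= u k + 2^-1 ^+ k.
Proof.
move=> uP.
have mono n k : u n <= u (n + k)%N.
  elim: k => [|k IH]; rewrite ?addn0 // addnS (le_trans IH) //.
  by have /andP[] := uP (n + k)%N.
have anti n k : u (n + k)%N + 2^-1 ^+ (n + k) <= u n + 2^-1 ^+ n.
  elim: k => [|k IH]; rewrite ?addn0 // addnS; apply: le_trans IH.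
  have /andP[_] := uP (n + k)%N; move: (u _) (u _) => a b.
  by rewrite exprS; lra.
have ub n k : u k <= u n + 2^-1 ^+ n.
  apply: le_trans (mono k n) _; rewrite addnC; apply: le_trans (anti n k).
  by rewrite lerDl exprn_ge0 // invr_ge0.
exists (sup [set u k | k in setT]) => k; apply/andP; split.
  apply: ub_le_sup; last by exists k.
  by exists (u 0%N + 2^-1 ^+ 0) => _ [n _ <-]; apply: ub.
apply: ge_sup; first by exists (u 0%N), 0%N.
by move=> _ [n _ <-]; apply: ub.
Qed.

(** [P x y k] speaks of the dyadic square with lower left corner (x, y) and side 2^-k. If it failed
    on the unit square, every failing square would have a failing quarter; the nested failing
    squares shrink to a point, where the local hypothesis is violated. *)
Lemma bisection (P : R -> R -> nat -> Prop) :
  (forall x y k, let h := 2^-1 ^+ k.+1 in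
     P x y k.+1 -> P (x + h) y k.+1 -> P x (y + h) k.+1 ->
     P (x + h) (y + h) k.+1 -> P x y k) ->
  (forall x y, 0 <= x <= 1 -> 0 <= y <= 1 -> exists K, forall k x' y',
     (K <= k)%N -> x' <= x <= x' + 2^-1 ^+ k -> y' <= y <= y' + 2^-1 ^+ k ->
     P x' y' k) ->
  P 0 0 0%N.
Proof.
move=> Pstep Ploc; apply: contrapT => P0.
pose next k (z : R * R) : R * R := let h := 2^-1 ^+ k.+1 in
  if ~~ `[< P z.1 z.2 k.+1 >] then z else
  if ~~ `[< P (z.1 + h) z.2 k.+1 >] then (z.1 + h, z.2) else
  if ~~ `[< P z.1 (z.2 + h) k.+1 >] then (z.1, z.2 + h) else
  (z.1 + h, z.2 + h).
pose s := fix s k : R * R := if k is n.+1 then next n (s n) else (0, 0).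
have h0 k : (0 : R) <= 2^-1 ^+ k by rewrite exprn_ge0 // invr_ge0.
have sP k : ~ P (s k).1 (s k).2 k.
  elim: k => [//|k IH] /=; rewrite /next.
  case: ifPn => [/asboolPn //|/negPn/asboolP P1].
  case: ifPn => [/asboolPn //|/negPn/asboolP P2].
  case: ifPn => [/asboolPn //|/negPn/asboolP P3] /= P4.
  exact: IH (Pstep _ _ _ P1 P2 P3 P4).
have s1 k : (s k).1 <= (s k.+1).1 <= (s k).1 + 2^-1 ^+ k.+1.
  rewrite /= /next; do !case: ifP => _ /=;
  by rewrite ?lexx ?lerDl ?h0.
have s2 k : (s k).2 <= (s k.+1).2 <= (s k).2 + 2^-1 ^+ k.+1.
  rewrite /= /next; do !case: ifP => _ /=;
  by rewrite ?lexx ?lerDl ?h0.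
have [x xP] := nested_point s1; have [y yP] := nested_point s2.
have [||K KP] := Ploc x y.
- by have := xP 0%N; rewrite /= add0r.
- by have := yP 0%N; rewrite /= add0r.
exact: sP (KP K _ _ (leqnn K) (xP K) (yP K)).
Qed.

End Bisection.

Lemma CD (R : realType) (x y : R) : (x + y)%:C = x%:C + y%:C.
Proof. exact: rmorphD. Qed.

Lemma CB (R : realType) (x y : R) : (x - y)%:C = x%:C - y%:C.
Proof. exact: rmorphB. Qed.

Lemma CM (R : realType) (x y : R) : (x * y)%:C = x%:C * y%:C.
Proof. exact: rmorphM. Qed.

Lemma C2V (R : realType) : (2^-1 : R)%:C = 2^-1.
Proof. by rewrite fmorphV rmorph_nat. Qed.

Section Contour.
Variables (R : realType) (F : normedModType R[i]).
Local Notation C := R[i].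
Implicit Types (g : C^o -> F) (p d a b : C).

(* Trapezoid rule with 2^N subintervals for the integral of g over [p, p + d]. *)
Fixpoint seg g N p d : F :=
  if N is n.+1 then seg g n p (d / 2) + seg g n (p + d / 2) (d / 2)
  else (d / 2) *: (g p + g (p + d)).

Definition contour g N p a b : F :=
  seg g N p a + seg g N (p + a) b - seg g N (p + b) a - seg g N p b.

Lemma half_lt (t : R) : 0 <= t <= 1 -> 0 <= t / 2 <= 1 /\ 0 <= 1 / 2 + t / 2 <= 1.
Proof. by move=> /andP[? ?]; split; apply/andP; split; lra. Qed.

Lemma nm2V : nm (2^-1 : C) = 2^-1 :> R.
Proof.
by rewrite -C2V nmR ger0_norm // invr_ge0.
Qed.

Lemma nmhalf d : nm (d / 2) = nm d / 2.
Proof. by rewrite nmM nm2V. Qed.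

Lemma seg_le g N p d (M : R) :
  (forall t : R, 0 <= t <= 1 -> nm (g (p + t%:C * d)) <= M) ->
  nm (seg g N p d) <= nm d * M.
Proof.
elim: N p d => [|N IH] p d gM /=.
  rewrite nmZ nmhalf -mulrA ler_wpM2l ?nm_ge0 // mulrC ler_pdivrMr //.
  apply: le_trans (nmD _ _) _; rewrite mulr_natr mulr2n; apply: lerD.
    by have := gM 0; rewrite mul0r addr0 lexx /= ler01; apply.
  by have := gM 1; rewrite mul1r lexx ler01; apply.
apply: le_trans (nmD _ _) _.
have -> : nm d * M = nm (d / 2) * M + nm (d / 2) * M by rewrite nmhalf; lra.
apply: lerD; apply: IH => t t01; have [t1 t2] := half_lt t01.
  have -> : p + t%:C * (d / 2) = p + (t / 2)%:C * d; last exact: gM.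
  by rewrite CM C2V; ring.
have -> : p + d / 2 + t%:C * (d / 2) = p + (1 / 2 + t / 2)%:C * d; last exact: gM.
by rewrite CD !CM C2V; field.
Qed.

Lemma segD g g' N p d :
  seg (fun w => g w + g' w) N p d = seg g N p d + seg g' N p d.
Proof.
elim: N p d => [|N IH] p d /=; last by rewrite !IH addrACA.
by rewrite -scalerDr addrACA.
Qed.

(** If a single trapezoid already gives [c] and [c] is additive under halving, refinement changes
    nothing: this is the exactness of the rule on constants and on affine functions. *)
Lemma seg_scal (s : C -> C) (c : C -> C -> C) (l : F) N p d :
  (forall p d, d / 2 * (s p + s (p + d)) = c p d) ->
  (forall p d, c p (d / 2) + c (p + d / 2) (d / 2) = c p d) ->
  seg (fun w => s w *: l) N p d = c p d *: l.
Proof.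
move=> c0 cS; elim: N p d => [|N IH] p d /=.
  by rewrite -scalerDl scalerA c0.
by rewrite !IH -scalerDl cS.
Qed.

Lemma seg_cst (c : F) N p d : seg (fun=> c) N p d = d *: c.
Proof.
have -> : (fun=> c) = (fun w : C^o => (1 : C) *: c) by apply/funext => w; rewrite scale1r.
by apply: (@seg_scal (fun=> 1) (fun _ d => d)) => p' d'; field.
Qed.

Lemma seg_lin (q : C) (l : F) N p d :
  seg (fun w => (w - q) *: l) N p d = (d * (p + d / 2 - q)) *: l.
Proof.
by apply: (@seg_scal (fun w => w - q) (fun p d => d * (p + d / 2 - q))) => p' d'; field.
Qed.

Lemma seg_periodic g N p d (b : C) : (forall w, g (w + b) = g w) ->
  seg g N (p + b) d = seg g N p d.
Proof.
move=> gb; elim: N p d => [|N IH] p d /=.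
  by rewrite (addrAC p) !gb.
by rewrite (addrAC p) !IH.
Qed.

(** A side at level N+1 is two half sides at level N, and the inner sides of the four quarters
    cancel in pairs. *)
Lemma contourS g N p a b : contour g N.+1 p a b =
  contour g N p (a / 2) (b / 2) + contour g N (p + a / 2) (a / 2) (b / 2) +
  contour g N (p + b / 2) (a / 2) (b / 2) +
  contour g N (p + a / 2 + b / 2) (a / 2) (b / 2).
Proof.
rewrite /contour /=.
rewrite (_ : p + a / 2 + b / 2 + a / 2 = p + a + b / 2); last by field.
rewrite (_ : p + a / 2 + b / 2 + b / 2 = p + b + a / 2); last by field.
rewrite (_ : p + b / 2 + a / 2 = p + a / 2 + b / 2); last by ring.
rewrite (_ : p + a / 2 + a / 2 = p + a); last by field.
rewrite (_ : p + b / 2 + b / 2 = p + b); last by field.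
by mod_eq R[i].
Qed.

Lemma contour_le g N p a b (M : R) :
  (forall s t : R, 0 <= s <= 1 -> 0 <= t <= 1 ->
     nm (g (p + s%:C * a + t%:C * b)) <= M) ->
  nm (contour g N p a b) <= 2 * (nm a + nm b) * M.
Proof.
move=> gM; rewrite /contour.
have h0 : (0 : R) <= (0 : R) <= (1 : R) by apply/andP; split; lra.
have h1 : (0 : R) <= (1 : R) <= (1 : R) by apply/andP; split; lra.
have b1 : nm (seg g N p a) <= nm a * M.
  by apply: seg_le => t t01; have := gM t 0 t01 h0; rewrite mul0r addr0.
have b2 : nm (seg g N (p + a) b) <= nm b * M.
  by apply: seg_le => t t01; have := gM 1 t h1 t01; rewrite mul1r.
have b3 : nm (seg g N (p + b) a) <= nm a * M.
  by apply: seg_le => t t01; have := gM t 1 t01 h1; rewrite mul1r addrAC.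
have b4 : nm (seg g N p b) <= nm b * M.
  by apply: seg_le => t t01; have := gM 0 t h0 t01; rewrite mul0r addr0.
apply: le_trans (nmB _ _) _.
apply: le_trans (lerD (le_trans (nmB _ _) (lerD (nmD _ _) (lexx _))) (lexx _)) _.
by lra.
Qed.

Lemma contour_affine g (g' : C^o -> F) (c l : F) q N p a b :
  (forall w, g w = g' w + (c + (w - q) *: l)) ->
  contour g N p a b = contour g' N p a b.
Proof.
move=> gE; have -> : g = (fun w => g' w + (c + (w - q) *: l)) by apply/funext.
rewrite /contour !segD !seg_cst !seg_lin; mod_eq R[i].
Qed.

Theorem goursat g p a b :
  (forall x y : R, 0 <= x <= 1 -> 0 <= y <= 1 ->
     differentiable g (p + x%:C * a + y%:C * b : C^o)) ->
  forall e : R, 0 < e -> exists N0, forall N, (N0 <= N)%N ->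
    nm (contour g N p a b) <= e.
Proof.
move=> dg e e0.
(* The tolerance is proportional to the area, so the four quarters add up to their parent. The
   threshold for N is hidden inside [P], since it rises by one at each subdivision. *)
pose P (x y : R) k := exists N0, forall N, (N0 <= N)%N ->
  nm (contour g N (p + x%:C * a + y%:C * b) (a * 2^-1 ^+ k) (b * 2^-1 ^+ k))
    <= e * 4^-1 ^+ k.
suff: P 0 0 0%N by rewrite /P !mul0r !addr0 !expr0 !mulr1.
have powC k : ((2^-1 : R) ^+ k)%:C = (2^-1 : C) ^+ k.
  by rewrite rmorphXn /= C2V.
apply: bisection => [x y k h [N1 P1] [N2 P2] [N3 P3] [N4 P4]|x y x01 y01].
  exists (maxn (maxn N1 N2) (maxn N3 N4)).+1 => -[//|N].
  rewrite ltnS !geq_max => /andP[/andP[n1 n2] /andP[n3 n4]].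
  rewrite contourS -!mulrA -!exprSr.
  have ->: e * 4^-1 ^+ k = e * 4^-1 ^+ k.+1 + e * 4^-1 ^+ k.+1 +
     e * 4^-1 ^+ k.+1 + e * 4^-1 ^+ k.+1 by rewrite exprSr; field.
  have q1 : p + x%:C * a + y%:C * b + a * 2^-1 ^+ k.+1 =
      p + (x + h)%:C * a + y%:C * b by rewrite CD powC; ring.
  have q2 : p + x%:C * a + y%:C * b + b * 2^-1 ^+ k.+1 =
      p + x%:C * a + (y + h)%:C * b by rewrite CD powC; ring.
  have q3 : p + (x + h)%:C * a + y%:C * b + b * 2^-1 ^+ k.+1 =
      p + (x + h)%:C * a + (y + h)%:C * b by rewrite !CD powC; ring.
  rewrite q1 q2 q3.
  apply: le_trans (nmD _ _) _; apply: lerD; last exact: P4.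
  apply: le_trans (nmD _ _) _; apply: lerD; last exact: P3.
  by apply: le_trans (nmD _ _) _; apply: lerD; [exact: P1|exact: P2].
pose q : C^o := p + x%:C * a + y%:C * b.
pose c := nm a + nm b.
have c0 : 0 <= c by rewrite addr_ge0 ?nm_ge0.
have dq : differentiable g q := dg x y x01 y01.
(* On a square of side 2^-k the perimeter is 2 c 2^-k and the first-order remainder is at most eta c
   2^-k, so the sum is at most 2 c^2 eta 4^-k <= e 4^-k. The added 1 covers c = 0. *)
have eta0 : 0 < e / (2 * (c ^+ 2 + 1)).
  by rewrite divr_gt0 // mulr_gt0 // ltr_wpDl ?exprn_ge0.
have [d d0 dP] := diff_approx dq eta0.
have [K KP] := @pow2V_lt R (d / (c + 1)) ltac:(by rewrite divr_gt0 // ltr_wpDl).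
exists K => k x' y' Kk x'x y'y; exists 0%N => N _.
set eta := e / _ in dP eta0.
pose l := dd g q (1 : C^o).
pose r w := g w - g q - (w - q) *: l.
(* The affine part of [g] at [q] contributes nothing, at any level N; only the remainder [r] is left
   to estimate. *)
rewrite (@contour_affine _ r (g q) l q); last by move=> w; rewrite /r; mod_eq R[i].
have rk0 : (0 : R) <= 2^-1 ^+ k by rewrite exprn_ge0 // invr_ge0.
have nk : nm (2^-1 ^+ k : C) = 2^-1 ^+ k :> R by rewrite nmX nm2V.
apply: le_trans (@contour_le _ _ _ _ _ (eta * (2^-1 ^+ k * c)) _) _.
  move=> s t s01 t01.
  set w := _ + t%:C * _; rewrite /r.
  have wq : w - q = (x' + s * 2^-1 ^+ k - x)%:C * a + (y' + t * 2^-1 ^+ k - y)%:C * b.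
    by rewrite /w /q !CB !CD !CM powC; ring.
  have small (u u' v : R) : u' <= u <= u' + 2^-1 ^+ k -> 0 <= v <= 1 ->
      `|u' + v * 2^-1 ^+ k - u| <= 2^-1 ^+ k.
    by move=> /andP[? ?] /andP[? ?]; rewrite ler_norml; nra.
  have nwq : nm (w - q) <= 2^-1 ^+ k * c.
    rewrite wq; apply: le_trans (nmD _ _) _; rewrite !nmM !nmR mulrDr.
    by apply: lerD; rewrite ler_wpM2r ?nm_ge0 ?small.
  have nwq' : nm (w - q) < d.
    apply: le_lt_trans nwq _; have := KP k Kk.
    rewrite ltr_pdivlMr ?ltr_wpDl //; apply: le_lt_trans.
    by rewrite ler_wpM2l // lerDl.
  have := dP (w - q) nwq'.
  have -> : q + (w - q) = w by rewrite addrC subrK.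
  have -> : dd g q (w - q) = (w - q) *: l.
    by rewrite -[in LHS](mulr1 (w - q)) -[_ * 1]/((w - q) *: (1 : C^o)) linearZ.
  move=> /le_trans; apply; rewrite ler_wpM2l ?nwq //; exact: ltW.
rewrite !nmM nk -mulrDl -/c.
have -> : (4^-1 : R) ^+ k = 2^-1 ^+ k * 2^-1 ^+ k.
  by rewrite -exprMn -invfM -natrM.
have -> : 2 * (c * 2^-1 ^+ k) * (eta * (2^-1 ^+ k * c)) =
  (2 * c ^+ 2 * eta) * (2^-1 ^+ k * 2^-1 ^+ k) by ring.
rewrite ler_wpM2r ?mulr_ge0 // /eta mulrA ler_pdivrMr ?mulr_gt0 //; last first.
  by rewrite ltr_wpDl ?exprn_ge0.
by lra.
Qed.

End Contour.

(** * The complex exponential *)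

Section Exponential.
Variable R : realType.
Local Notation C := R[i].

Lemma mvt_bound (f df : R -> R) (b M : R) :
  (forall x : R, is_derive x (1 : R) f (df x)) ->
  (forall x, `|x| <= `|b| -> `|df x| <= M) -> `|f b - f 0| <= M * `|b|.
Proof.
move=> fd dM.
have cf : continuous f.
  by move=> x; apply/differentiable_continuous/derivable1_diffP; case: (fd x).
have [b0|b0] := leP 0 b.
  have [c] := MVT_segment b0 (fun x _ => fd x) (continuous_subspaceT cf).
  rewrite in_itv /= => /andP[c0 cb] ->; rewrite subr0 normrM ler_wpM2r //.
  by apply: dM; rewrite !ger0_norm.
have [c] := MVT_segment (ltW b0) (fun x _ => fd x) (continuous_subspaceT cf).
rewrite in_itv /= => /andP[cb c0]; rewrite distrC => ->.
rewrite sub0r normrM normrN ler_wpM2r //.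
by apply: dM; rewrite !ler0_norm ?lerN2 // ltW.
Qed.

Lemma sin_bound (b : R) : `|sin b| <= `|b|.
Proof.
rewrite -[sin b]subr0 -[X in _ - X]sin0 -[leRHS]mul1r.
by apply: (mvt_bound (df := cos)) => x _; rewrite ?cos_max.
Qed.

Lemma cos_bound (b : R) : `|cos b - 1| <= `|b| ^+ 2.
Proof.
rewrite -cos0 expr2.
by apply: (mvt_bound (df := fun x => - sin x)) => x xb; rewrite normrN (le_trans (sin_bound x)).
Qed.

Lemma sin_bound2 (b : R) : `|b| <= 1 -> `|sin b - b| <= `|b| ^+ 2.
Proof.
move=> b1; have -> : sin b - b = (sin b - b) - (sin 0 - 0) by rewrite sin0; ring.
rewrite expr2.
apply: (mvt_bound (f := fun x => sin x - x) (df := fun x => cos x - 1)) => x xb.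
apply: le_trans (cos_bound x) _.
by have := normr_ge0 x; nra.
Qed.

(** Both sides come from 1 + x <= exp x: directly at [a], and at [- a] through exp a * exp (- a) =
    1, which yields exp a <= 1 / (1 - a). *)
Lemma expR_bound (a : R) : `|a| <= 1 / 2 -> `|expR a - 1 - a| <= 2 * `|a| ^+ 2.
Proof.
move=> a2; have lo := expR_ge1Dx a; have lo' := expR_ge1Dx (- a).
have hi : expR a * expR (- a) = 1 := expRxMexpNx_1 a.
have e0 := expR_gt0 a.
have /andP[a3 a4] : - (1 / 2) <= a <= 1 / 2 by rewrite -ler_norml.
rewrite ger0_norm; last by lra.
rewrite real_normK ?num_real //.
have : expR a * (1 - a) <= 1 by rewrite -[leRHS]hi ler_wpM2l // ltW.
nra.
Qed.

Definition cexp (w : C^o) : C^o :=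
  (expR (complex.Re w))%:C * (cos (complex.Im w) +i* sin (complex.Im w)).

Lemma cexpD (w h : C^o) : cexp (w + h) = cexp w * cexp h.
Proof.
case: w => a b; case: h => c d; rewrite /cexp /= expRD cosD sinD.
by apply/eqP; rewrite eq_complex /=; apply/andP; split; apply/eqP; ring.
Qed.

Lemma nm_ReIm (z : C) : nm z <= `|complex.Re z| + `|complex.Im z|.
Proof.
rewrite {1}(complexE z); case: z => a b; apply: le_trans (nmD _ _) _.
rewrite nmM !nmR /=.
have -> : nm ('i : C) = 1.
  by apply: complexI; rewrite -nmE normc_def /= expr0n expr1n add0r sqrtr1.
by rewrite mul1r.
Qed.

Lemma nm_Re (z : C) : `|complex.Re z| <= nm z.
Proof. by rewrite -lecR -nmE normc_ge_Re. Qed.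

Lemma nm_Im (z : C) : `|complex.Im z| <= nm z.
Proof.
rewrite -lecR -nmE normc_def lecR; case: z => a b /=.
by rewrite -sqrtr_sqr ler_wsqrtr // lerDr sqr_ge0.
Qed.

Lemma nm_cexp (w : C) : nm (cexp w) = expR (complex.Re w).
Proof.
rewrite nmM nmR ger0_norm ?expR_ge0 // -[RHS]mulr1; congr (_ * _).
by apply: complexI; rewrite -nmE normc_def /= cos2Dsin2 sqrtr1.
Qed.

Definition two_pi_i : C := (0 : R) +i* (pi *+ 2).

Lemma cexp_periodic (w : C) : cexp (w + two_pi_i) = cexp w.
Proof. by case: w => a b; rewrite /cexp /= addr0 cosD2pi sinD2pi. Qed.

Lemma nm_two_pi_i : nm two_pi_i = pi *+ 2.
Proof.
apply: complexI; rewrite -nmE normc_def /= expr0n add0r sqrtr_sqr ger0_norm //.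
by rewrite mulrn_wge0 // ltW ?pi_gt0.
Qed.

(** Only the quadratic order matters; 20 = 4 + 16 adds crude bounds for the real and the imaginary
    part. The functional equation carries the estimate from 0 to every other point. *)
Lemma cexp_approx (h : C) : nm h <= 1 / 2 -> nm (cexp h - 1 - h) <= 20 * nm h ^+ 2.
Proof.
move=> h2; have := nm_Re h; have := nm_Im h.
have := nm_ReIm (cexp h - 1 - h); move: (nm (_ - _)) (nm_ge0 h) h2 => X.
move: (nm h) => n; case: h => a b /= n0 n2 XR bn an.
apply: le_trans XR _.
have a2 : `|a| <= 1 / 2 by apply: le_trans n2.
have b2 : `|b| <= 1 / 2 by apply: le_trans n2.
have ea := expR_bound a2; have cb := cos_bound b.
have sb : `|sin b - b| <= `|b| ^+ 2 by apply: sin_bound2; lra.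
have ge2 : expR a <= 2.
  have := expRxMexpNx_1 a; have := expR_ge1Dx (- a); have := expR_gt0 a.
  have : a <= 1 / 2 by apply: le_trans a2; exact: ler_norm.
  nra.
have e0 := expR_ge0 a.
have an2 : `|a| ^+ 2 <= n ^+ 2 by rewrite lerXn2r ?nnegrE.
have bn2 : `|b| ^+ 2 <= n ^+ 2 by rewrite lerXn2r ?nnegrE.
have re : `|expR a * cos b - 0 * sin b - 1 - a| <= 4 * n ^+ 2.
  have -> : expR a * cos b - 0 * sin b - 1 - a =
    (expR a - 1 - a) + expR a * (cos b - 1) by ring.
  apply: le_trans (ler_normD _ _) _; rewrite normrM (ger0_norm e0).
  by have := ler_pM e0 (normr_ge0 _) ge2 cb; lra.
have im : `|expR a * sin b + 0 * cos b - 0 - b| <= 16 * n ^+ 2.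
  have -> : expR a * sin b + 0 * cos b - 0 - b =
    expR a * (sin b - b) + ((expR a - 1 - a) * b + a * b) by ring.
  apply: le_trans (ler_normD _ _) _; rewrite normrM (ger0_norm e0).
  have : `|(expR a - 1 - a) * b + a * b| <= 3 * n ^+ 2.
    apply: le_trans (ler_normD _ _) _; rewrite !normrM.
    have : `|a| * `|b| <= n * n by rewrite ler_pM.
    have : `|expR a - 1 - a| * `|b| <= (2 * n ^+ 2) * 1.
      by rewrite ler_pM //; [apply: le_trans ea _; lra|lra].
    by rewrite expr2; lra.
  by have := ler_pM e0 (normr_ge0 _) ge2 sb; have := sqr_ge0 n; lra.
by apply: le_trans (lerD re im) _; lra.
Qed.

Lemma differentiable_cexp (w : C^o) : differentiable cexp w.
Proof.
apply: (@diff_intro _ C^o C^o cexp w (fun h => cexp w * h) (nm (cexp w)) _ _ _).1.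
- by move=> k x y; rewrite mulrDr -[k *: x]/(k * x) mulrCA.
- by move=> h; rewrite -nmM.
move=> e e0; pose c := nm (cexp w).
have c0 : 0 <= c := nm_ge0 _.
exists (Num.min (1 / 2) (e / (20 * (c + 1)))).
  by rewrite lt_min divr_gt0 ?divr_gt0 ?mulr_gt0 ?ltr_wpDl.
move=> h; rewrite lt_min => /andP[/ltW h2]; rewrite ltr_pdivlMr ?mulr_gt0 ?ltr_wpDl // => he.
have -> : cexp (w + h) - cexp w - cexp w * h = cexp w * (cexp h - 1 - h :> C).
  by rewrite cexpD; ring.
rewrite nmM -/c; apply: le_trans (ler_wpM2l c0 (cexp_approx h2)) _.
have := nm_ge0 h; nra.
Qed.

End Exponential.

(** * The mean value property *)

Section MeanValue.
Variables (R : realType) (F : normedModType R[i]).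
Local Notation C := R[i].
Implicit Type f : C^o -> F.

(* The discretised integral of f(z) dz / z over the circle |z| = s. *)
Definition circ f N (s : R) : F := seg (f \o @cexp R) N (ln s)%:C (two_pi_i R).

Lemma Re_scale (t : R) (z : C) : complex.Re (t%:C * z) = t * complex.Re z.
Proof. by case: z => a b /=; rewrite mul0r subr0. Qed.

Lemma ReD (w z : C) : complex.Re (w + z) = complex.Re w + complex.Re z.
Proof. by case: w => a b; case: z. Qed.

Lemma circ_le f N s (M : R) : 0 < s -> (forall z, nm z = s -> nm (f z) <= M) ->
  nm (circ f N s) <= pi *+ 2 * M.
Proof.
move=> s0 fM; rewrite /circ -nm_two_pi_i; apply: seg_le => t _ /=.
by apply: fM; rewrite nm_cexp ReD Re_scale /= mulr0 addr0 lnK.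
Qed.

Lemma circB f g N s : circ (fun z => f z - g z) N s = circ f N s - circ g N s.
Proof.
rewrite /circ (_ : _ \o _ = fun w => (f \o @cexp R) w + (-1 : C) *: (g \o @cexp R) w).
  rewrite segD; congr (_ + _).
  have segZ h k p d : seg (fun w : C^o => (-1 : C) *: (h w : F)) k p d = - seg h k p d.
    elim: k p d => [|k IH] p d /=; last by rewrite !IH opprD.
    by mod_eq R[i].
  exact: segZ.
by apply/funext => w /=; rewrite scaleN1r.
Qed.

(** The exponential maps the rectangle with opposite corners ln r and ln s + 2 pi i onto the annulus
    between the circles of radii r and s. By periodicity the two sides joining the circles cancel,
    so Goursat's lemma makes the sums over both circles agree in the limit. The radius r is so small
    that continuity at 0 replaces f by f(0) there. Asking only continuity at 0 admits the difference
    quotients [slope]. *)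
Theorem mean_value f s : 0 < s ->
  (forall z, 0 < nm z -> nm z <= s -> differentiable f z) ->
  (forall e : R, 0 < e -> exists2 d : R, 0 < d &
    forall z, nm z < d -> nm (f z - f 0) <= e) ->
  forall e : R, 0 < e -> exists N0, forall N, (N0 <= N)%N ->
    nm (circ f N s - two_pi_i R *: f 0) <= e.
Proof.
move=> s0 df cf e e0.
have pi0 := pi_gt0 R.
have [d d0 dP] := cf (e / (pi *+ 2) / 2) ltac:(by rewrite !divr_gt0 // mulrn_wgt0).
pose r := Num.min (d / 2) s.
have r0 : 0 < r by rewrite lt_min divr_gt0.
have rs : r <= s by rewrite ge_min lexx orbT.
have rd : r < d by rewrite gt_min ltr_pdivrMr // ltr_pMr // ltr1n.
have lrs : ln r <= ln s by rewrite ler_ln.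
pose p : C := (ln r)%:C.
pose a : C := (ln s - ln r)%:C.
have [|N0 NP] := @goursat R F (f \o @cexp R) p a (two_pi_i R) _ (e / 2) ltac:(by rewrite divr_gt0).
  move=> x y /andP[x0 x1] _; apply: differentiable_comp; first exact: differentiable_cexp.
  apply: df; rewrite nm_cexp ?expR_gt0 //.
  rewrite !ReD !Re_scale /= mulr0 addr0 -[leRHS]lnK ?posrE // ler_expR.
  by nra.
exists N0 => N N0N; have := NP N N0N; rewrite /contour.
have -> : p + a = (ln s)%:C by rewrite /p /a -CD addrC subrK.
rewrite seg_periodic; last by move=> w /=; rewrite cexp_periodic.
rewrite -/(circ f N s) -/(circ f N r) (addrC (seg _ _ _ _)) addrK => small.
have -> : circ f N s - two_pi_i R *: f 0 =
    (circ f N s - circ f N r) + (circ f N r - two_pi_i R *: f 0).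
  by rewrite addrA subrK.
apply: le_trans (nmD _ _) _; rewrite (splitr e); apply: lerD => //.
have -> : two_pi_i R *: f 0 = circ (fun=> f 0) N r by rewrite -[RHS]/(seg (fun=> f 0) N (ln r)%:C (two_pi_i R)) seg_cst.
rewrite -circB.
apply: le_trans (circ_le _ r0 (M := e / (pi *+ 2) / 2) _) _.
  by move=> z zr; apply: dP; rewrite zr.
have : (pi : R) *+ 2 != 0 by rewrite gt_eqF // mulrn_wgt0.
move: (_ *+ 2) => q q0; rewrite le_eqVlt; apply/orP; left; apply/eqP.
by field.
Qed.

End MeanValue.

(** * The mean value inequality along a segment *)

Section MeanValueInequality.
Variables (R : realType) (V F : normedModType R[i]).
Local Notation C := R[i].

Lemma mean_value_inequality (f : V -> F) (x v : V) (L : R) :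
  (forall t : R, 0 <= t <= 1 -> differentiable f (x + t%:C *: v)) ->
  (forall t : R, 0 <= t <= 1 -> nm (dd f (x + t%:C *: v) v) <= L) ->
  nm (f (x + v) - f x) <= L.
Proof.
move=> df dL; apply/ler_addgt0Pr => e e0.
(* Bisection of the interval [0, 1]: [P] ignores the second coordinate. The slack [e] absorbs the
   first-order remainder on short intervals. *)
pose P (u _ : R) k := nm (f (x + (u + 2^-1 ^+ k)%:C *: v) - f (x + u%:C *: v))
  <= (L + e) * 2^-1 ^+ k.
suff: P 0 0 0%N by rewrite /P expr0 add0r mulr1 scale1r scale0r addr0.
apply: (@bisection _ P) => [u w k h P1 P2 _ _|u w u01 _].
  move: P1 P2; rewrite /P -/h => P1 P2.
  have -> : (L + e) * 2^-1 ^+ k = (L + e) * h + (L + e) * h.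
    by rewrite /h exprS; field.
  have -> : u + 2^-1 ^+ k = u + h + h by rewrite /h exprS; field.
  set y := f _ in P2 *; set z := f _ in P1 P2 *.
  have -> : y - f (x + u%:C *: v) = (y - z) + (z - f (x + u%:C *: v)).
    by rewrite addrA subrK.
  by apply: le_trans (nmD _ _) _; apply: lerD.
have dfu := df u u01.
pose c := nm v; have c0 : 0 <= c := nm_ge0 v.
have eta0 : 0 < e / (c + 1) by rewrite divr_gt0 // ltr_wpDl.
have [d d0 dP] := diff_approx dfu eta0.
have [K KP] := @pow2V_lt R (d / (c + 1)) ltac:(by rewrite divr_gt0 // ltr_wpDl).
exists K => k u' w' Kk /andP[u1 u2] _; rewrite /P.
set h := 2^-1 ^+ k in u2 *.
have h0 : 0 <= h by rewrite exprn_ge0 // invr_ge0.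
have hd : h * c < d.
  have := KP k Kk; rewrite -/h ltr_pdivlMr ?ltr_wpDl //; apply: le_lt_trans.
  by rewrite ler_wpM2l // lerDl.
pose g (t : R) := f (x + (u + t)%:C *: v) - f (x + u%:C *: v) - t%:C *: dd f (x + u%:C *: v) v.
have gP t : `|t| <= h -> nm (g t) <= e / (c + 1) * (`|t| * c).
  move=> th; have := dP (t%:C *: v); rewrite nmZ nmR -/c linearZ /=.
  have -> : x + u%:C *: v + t%:C *: v = x + (u + t)%:C *: v by rewrite CD; mod_eq R[i].
  by apply; apply: le_lt_trans hd; rewrite ler_wpM2r.
(* Both endpoints are compared with the point [u] between them, the only place where
   differentiability has been used; their distances to [u] add up to [h]. *)
have -> : f (x + (u' + h)%:C *: v) - f (x + u'%:C *: v) =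
   (h%:C *: dd f (x + u%:C *: v) v + g (u' + h - u)) - g (u' - u).
  rewrite /g (_ : u + (u' + h - u) = u' + h); last by ring.
  rewrite (_ : u + (u' - u) = u'); last by ring.
  by rewrite !CB CD; mod_eq R[i].
have b1 : `|u' + h - u| = u' + h - u by rewrite ger0_norm // subr_ge0.
have b2 : `|u' - u| = u - u' by rewrite ler0_norm ?opprB // subr_le0.
have g1 : nm (g (u' + h - u)) <= e / (c + 1) * ((u' + h - u) * c).
  by have := gP (u' + h - u); rewrite b1; apply; lra.
have g2 : nm (g (u' - u)) <= e / (c + 1) * ((u - u') * c).
  by have := gP (u' - u); rewrite b2; apply; lra.
have g3 : nm (h%:C *: dd f (x + u%:C *: v) v) <= h * L.
  by rewrite nmZ nmR ger0_norm // ler_wpM2l // dL.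
have ec : e / (c + 1) * c <= e.
  by rewrite mulrAC ler_pdivrMr ?ltr_wpDl // ler_wpM2l ?ltW // ltrDl.
apply: le_trans (nmB _ _) _; apply: le_trans (lerD (nmD _ _) (lexx _)) _.
have := ler_wpM2l h0 ec; lra.
Qed.

End MeanValueInequality.

(** * Estimates in one variable *)

Section Differentiability.
Variables (R : realType) (V F : normedModType R[i]).
Local Notation C := R[i].

Lemma diff_continuous_nm (f : V -> F) a : differentiable f a ->
  forall e : R, 0 < e -> exists2 d : R, 0 < d &
  forall z, nm (z - a) < d -> nm (f z - f a) <= e.
Proof.
move=> /differentiable_continuous /cvgrPdist_le fc e e0.
have := fc e%:C; rewrite ltcR => /(_ e0) /near_nmP[d d0 dP].
by exists d => // z zd; rewrite nmBC -lecR -nmE dP.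
Qed.

Lemma differentiable_near (f g : V -> F) a (d : R) : 0 < d ->
  (forall z, nm (z - a) < d -> f z = g z) ->
  differentiable f a -> differentiable g a.
Proof.
move=> d0 fg df; have [K K0 KP] := diff_bounded df.
apply: (diff_intro (L := dd f a) _ KP _).1; first exact: dd_linear.
move=> e e0; have [d1 d10 d1P] := diff_approx df e0.
exists (Num.min d d1) => [|h]; first by rewrite lt_min d0.
rewrite lt_min => /andP[hd hd1]; rewrite -!fg ?subrr ?nm0 //; first exact: d1P.
by rewrite addrC addKr.
Qed.

Lemma differentiable_scale (k : V -> C^o) (f : V -> F) a :
  differentiable k a -> differentiable f a ->
  differentiable (fun z => (k z : C) *: f z) a.
Proof.
move=> dk df.
have bl : bilinear_for *:%R *:%R (fun (a : C^o) (x : F) => (a : C) *: x).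
  split=> [x c u v|u c x y] /=; first by rewrite scalerDl scalerA.
  by rewrite scalerDr !scalerA mulrC.
pose B := bilinear_isBilinear.Build C C^o F F _ _ _ bl.
pose b : {bilinear C^o -> F -> F} :=
  HB.pack (fun (a : C^o) (x : F) => (a : C) *: x) B.
apply: (@differentiable_comp _ _ _ _ (fun z => (k z, f z)) (fun p => b p.1 p.2)).
  exact: differentiable_pair.
by apply: differentiable_bilin; exact: scale_continuous.
Qed.

Lemma differentiable_slice (f : V -> F) (a v : V) (t : C) :
  differentiable f (a + t *: v) ->
  differentiable (fun t : C^o => f (a + t *: v)) (t : C^o) /\
  dd (fun t : C^o => f (a + t *: v)) (t : C^o) (1 : C^o) = dd f (a + t *: v) v.
Proof.
move=> df.
have [|||dg ->] := @diff_intro R C^o F (fun t : C^o => f (a + t *: v)) t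
  (fun h : C^o => (h : C) *: dd f (a + t *: v) v) (nm (dd f (a + t *: v) v)).
- by move=> c x y; rewrite scalerDl scalerA.
- by move=> h; rewrite nmZ mulrC.
- move=> e e0; pose c := nm v; have c0 : 0 <= c := nm_ge0 v.
  have [d d0 dP] := diff_approx df (e := e / (c + 1)) ltac:(by rewrite divr_gt0 // ltr_wpDl).
  exists (d / (c + 1)) => [|h]; first by rewrite divr_gt0 // ltr_wpDl.
  rewrite ltr_pdivlMr ?ltr_wpDl // => hd.
  have h0 := nm_ge0 h.
  have := dP (h *: v); rewrite nmZ -/c linearZ /=.
  have -> : a + t *: v + h *: v = a + (t + h) *: v by rewrite scalerDl addrA.
  move=> dP'; apply: le_trans (dP' _) _; first by nra.
  by rewrite mulrAC ler_pdivrMr ?ltr_wpDl //; have := mulr_ge0 (ltW e0) h0; nra.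
by rewrite scale1r.
Qed.

End Differentiability.

Section OneVariable.
Variables (R : realType) (F : normedModType R[i]).
Local Notation C := R[i].
Implicit Types (f : C^o -> F) (a b z : C^o).

Lemma diff_scalar f a h : dd f a h = (h : C) *: dd f a (1 : C^o).
Proof. by rewrite -[in LHS](mulr1 h) -[h * 1]/((h : C) *: (1 : C^o)) linearZ. Qed.

Lemma circle_bound (G : C^o -> F) (s B : R) : 0 < s ->
  (forall z, 0 < nm z -> nm z <= s -> differentiable G z) ->
  (forall e : R, 0 < e -> exists2 d : R, 0 < d &
    forall z, nm z < d -> nm (G z - G 0) <= e) ->
  (forall z, nm z = s -> nm (G z) <= B) -> nm (G 0) <= B.
Proof.
move=> s0 dG cG GB; apply/ler_addgt0Pr => e e0.
have q0 : 0 < (pi : R) *+ 2 by rewrite mulrn_wgt0 ?pi_gt0.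
have [N NP] := mean_value s0 dG cG (mulr_gt0 q0 e0).
have := NP N (leqnn N); have := circ_le N s0 GB.
set c := circ _ _ _ => cB; rewrite nmBC => cG0.
rewrite -(ler_pM2l q0) -nm_two_pi_i -nmZ nm_two_pi_i.
rewrite -[_ *: _](subrK c); apply: le_trans (nmD _ _) _.
by rewrite mulrDr addrC lerD.
Qed.

Definition slope f a z : F :=
  if z == 0 then dd f a (1 : C^o) else (z : C)^-1 *: (f (a + z) - f a).

Lemma slope_continuous f a : differentiable f a ->
  forall e : R, 0 < e -> exists2 d : R, 0 < d &
    forall z, nm z < d -> nm (slope f a z - slope f a 0) <= e.
Proof.
move=> df e e0; have [d d0 dP] := diff_approx df e0.
exists d => // z zd; rewrite /slope eqxx.
have [_|z0] := eqVneq z 0; first by rewrite subrr nm0 ltW.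
have nz := nm_gt0 z0; have := dP z zd; rewrite (diff_scalar f a z).
rewrite [X in _ -> nm X <= _](_ : _ =
  (z : C)^-1 *: (f (a + z) - f a - (z : C) *: dd f a (1 : C^o))); last first.
  by rewrite [RHS]scalerBr scalerA mulVf // scale1r.
by rewrite nmZ nmV ler_pdivrMl // mulrC.
Qed.

Lemma differentiable_slope f a z : z != 0 -> differentiable f (a + z) ->
  differentiable (slope f a) z.
Proof.
move=> z0 df.
apply: (@differentiable_near _ _ _
  (fun z : C^o => ((z : C^o)^-1 : C) *: (f (a + z) - f a)) _ z (nm z)).
- exact: nm_gt0.
- move=> w wz; rewrite /slope; case: eqP => // w0; move: wz.
  by rewrite w0 sub0r nmN ltxx.
apply: differentiable_scale.
  exact: (@differentiable_Rinv R[i] z z0).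
apply: differentiableB; last exact: differentiable_cst.
have := @differentiable_slice R C^o F f a 1 z.
rewrite [z *: _]mulr1 => /(_ df)[dg _].
by move: dg; congr (differentiable _ _); apply/funext => t; rewrite [t *: _]mulr1.
Qed.

Section Disc.
Variables (f : C^o -> F) (a : C^o) (r M : R).
Hypotheses (df : forall z, nm (z - a) < r -> differentiable f z)
  (fM : forall z, nm (z - a) < r -> nm (f z) <= M).

(** The derivative is the central value of the difference quotient, which on the circle of radius
    r/2 is at most 2 M / (r/2). *)
Lemma deriv_bound : 0 < r -> nm (dd f a (1 : C^o)) <= 4 * M / r.
Proof.
move=> r0; have r2 : 0 < r / 2 by rewrite divr_gt0.
have -> : dd f a (1 : C^o) = slope f a 0 by rewrite /slope eqxx.
have ain : nm (a - a) < r by rewrite subrr nm0.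
apply: (circle_bound r2).
- move=> z z0 zr; apply: differentiable_slope.
    by apply: contraTneq z0 => ->; rewrite nm0 ltxx.
  by apply: df; rewrite addrC addKr (le_lt_trans zr) // ltr_pdivrMr // ltr_pMr // ltr1n.
- exact/slope_continuous/df.
move=> z zr; rewrite /slope; case: eqP => [z0|_].
  by move: r2; rewrite -zr z0 nm0 ltxx.
rewrite nmZ nmV zr invf_div mulrC mulrA ler_pdivrMr // divfK ?gt_eqF //.
have : nm (f (a + z) - f a) <= M + M.
  apply: le_trans (nmB _ _) _; rewrite lerD ?fM //.
  by rewrite addrC addKr zr ltr_pdivrMr // ltr_pMr // ltr1n.
lra.
Qed.

End Disc.

Section Disc2.
Variables (f : C^o -> F) (a : C^o) (r M : R).
Hypotheses (r0 : 0 < r) (df : forall z, nm (z - a) < r -> differentiable f z)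
  (fM : forall z, nm (z - a) < r -> nm (f z) <= M).

Lemma nm_convex (x y c : C^o) (s t : R) : 0 <= t <= 1 ->
  nm (x - c) < s -> nm (y - c) < s -> nm (x + t%:C *: (y - x) - c) < s.
Proof.
move=> /andP[t0 t1] xs ys.
have -> : x + t%:C *: (y - x) - c = (1 - t)%:C *: (x - c) + t%:C *: (y - c).
  by rewrite CB; mod_eq R[i].
apply: le_lt_trans (nmD _ _) _; rewrite !nmZ !nmR !ger0_norm ?subr_ge0 //.
by have [AB|/ltW AB] := leP (nm (x - c)) (nm (y - c));
  [apply: le_lt_trans ys|apply: le_lt_trans xs]; nra.
Qed.

Lemma disc_half x : nm (x - a) < r / 2 -> forall z, nm (z - x) < r / 2 -> nm (z - a) < r.
Proof.
move=> xa z zx; rewrite -(subrK x z) -addrA; apply: le_lt_trans (nmD _ _) _; lra.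
Qed.

(** Around each point of the segment a disc of radius r/2 is available, so the derivative there is
    at most 4 M / (r/2). *)
Lemma lipschitz_bound x y : nm (x - a) < r / 2 -> nm (y - a) < r / 2 ->
  nm (f y - f x) <= 8 * M / r * nm (y - x).
Proof.
move=> xa ya; have yE : y = x + (y - x) by rewrite addrC subrK.
rewrite {1}yE.
have inside (t : R) : 0 <= t <= 1 -> nm (x + t%:C *: (y - x) - a) < r / 2.
  by move=> t01; apply: nm_convex.
apply: mean_value_inequality => t /inside ta.
  by apply: df; apply: lt_trans ta _; have := r0; lra.
rewrite (diff_scalar _ _ (y - x)) nmZ mulrC ler_wpM2r ?nm_ge0 //.
have -> : 8 * M / r = 4 * M / (r / 2) by field; rewrite gt_eqF.
apply: deriv_bound; rewrite ?divr_gt0 // => z /(disc_half ta); [exact: df|exact: fM].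
Qed.

(** A second-derivative bound that mentions no second derivative. The difference of the slopes at
    [b] and at [a] has central value f'(b) - f'(a); on the circle of radius r/4 its numerator
    consists of two increments over b - a, each at most (8 M / r) |b - a|, which gives 16 * 4 =
    64. *)
Lemma deriv_lipschitz b : nm (b - a) < r / 4 ->
  nm (dd f b (1 : C^o) - dd f a (1 : C^o)) <= 64 * M / r ^+ 2 * nm (b - a).
Proof.
move=> ba; have r4 : 0 < r / 4 by rewrite divr_gt0.
pose G z := slope f b z - slope f a z.
have dfa : differentiable f a by apply: df; rewrite subrr nm0.
have dfb : differentiable f b by apply: df; lra.
have -> : dd f b (1 : C^o) - dd f a (1 : C^o) = G 0 by rewrite /G /slope !eqxx.
have bz z : nm z <= r / 4 -> nm (b + z - a) < r / 2.
  by rewrite addrAC => zr; apply: le_lt_trans (nmD _ _) _; lra.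
have az z : nm z <= r / 4 -> nm (a + z - a) < r / 2.
  by rewrite addrC addKr => zr; lra.
apply: (circle_bound r4).
- move=> z z0 zr; have zn0 : z != 0 by apply: contraTneq z0 => ->; rewrite nm0 ltxx.
  have rr : r / 2 < r by have := r0; lra.
  have db : differentiable (slope f b) z.
    apply: (differentiable_slope zn0); apply: df; exact: lt_trans (bz z zr) rr.
  have da : differentiable (slope f a) z.
    apply: (differentiable_slope zn0); apply: df; exact: lt_trans (az z zr) rr.
  exact: (differentiableB db da).
- move=> e e0; have e2 : 0 < e / 2 by rewrite divr_gt0.
  have [d1 d10 d1P] := slope_continuous dfb e2.
  have [d2 d20 d2P] := slope_continuous dfa e2.
  exists (Num.min d1 d2) => [|z]; first by rewrite lt_min d10.
  rewrite lt_min => /andP[/d1P z1 /d2P z2].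
  have -> : G z - G 0 = (slope f b z - slope f b 0) - (slope f a z - slope f a 0).
    by rewrite /G; mod_eq R[i].
  by rewrite (splitr e); apply: le_trans (nmB _ _) _; apply: lerD.
move=> z zr; have zn0 : z != 0.
  by apply: contraTneq r4 => z0; rewrite -zr z0 nm0 ltxx.
have zr' : nm z <= r / 4 by rewrite zr.
rewrite /G /slope (negPf zn0) -scalerBr nmZ nmV zr invf_div.
have -> : f (b + z) - f b - (f (a + z) - f a) =
  (f (b + z) - f (a + z)) - (f b - f a) by mod_eq R[i].
have l1 := lipschitz_bound (az z zr') (bz z zr').
have l2 : nm (f b - f a) <= 8 * M / r * nm (b - a).
  by apply: lipschitz_bound; rewrite ?subrr ?nm0 ?divr_gt0 //; lra.
have e1 : b + z - (a + z) = b - a by rewrite opprD addrACA subrr addr0.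
rewrite e1 in l1.
apply: le_trans (ler_wpM2l _ (le_trans (nmB _ _) (lerD l1 l2))) _.
  by rewrite divr_ge0 // ltW.
rewrite le_eqVlt; apply/orP; left; apply/eqP; field; by rewrite gt_eqF.
Qed.

(** The mean value inequality is applied to g(z) = f(z) - z f'(a), whose derivative f'(z) - f'(a) is
    controlled by [deriv_lipschitz]. *)
Lemma taylor2_disc h : nm h < r / 4 ->
  nm (f (a + h) - f a - dd f a h) <= 64 * M / r ^+ 2 * nm h ^+ 2.
Proof.
move=> hr.
pose g z := f z - (z : C) *: dd f a (1 : C^o).
have -> : f (a + h) - f a - dd f a h = g (a + h) - g a.
  by rewrite /g (diff_scalar _ _ h); mod_eq R[i].
have dg (z : C^o) : differentiable f z -> differentiable g z /\
   dd g z = (fun w => (w : C) *: (dd f z (1 : C^o) - dd f a (1 : C^o))) .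
  move=> dfz; apply: (@diff_intro _ _ _ _ _ _ (nm (dd f z (1 : C^o) - dd f a (1 : C^o)))).
  - by move=> c x y; rewrite scalerDl scalerA.
  - by move=> w; rewrite nmZ mulrC.
  move=> e /(diff_approx dfz)[d d0 dP]; exists d => // w wd.
  have key : nm (f (z + w) - f z - (w : C) *: dd f z (1 : C^o)) <= e * nm w.
    by have := dP w wd; have := diff_scalar f z w; move: (dd f z w) => y ->.
  apply: le_trans key; rewrite /g le_eqVlt; apply/orP; left; apply/eqP; congr nm.
  have -> : ((z + w)%R : C) *: dd f a (1 : C^o) = (z : C) *: dd f a (1 : C^o) + (w : C) *: dd f a (1 : C^o).
    exact: scalerDl.
  move: (f (z + w)) (f z) (dd f z (1 : C^o)) (dd f a (1 : C^o)) => u u' v v'.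
  by mod_eq R[i].
have ins (t : R) : 0 <= t <= 1 -> nm (t%:C *: h) <= nm h.
  by move=> /andP[t0 t1]; rewrite nmZ nmR ger0_norm // ler_piMl ?nm_ge0.
have dft (t : R) : 0 <= t <= 1 -> differentiable f (a + t%:C *: h).
  by move=> t01; apply: df; rewrite addrC addKr; have := ins t t01; have := r0; lra.
apply: mean_value_inequality => t t01; first by case: (dg _ (dft t t01)).
rewrite (dg _ (dft t t01)).2 /= nmZ.
rewrite mulrC expr2 mulrA ler_wpM2r ?nm_ge0 //.
have small : nm (a + t%:C *: h - a) < r / 4.
  by rewrite addrC addKr; have := ins t t01; lra.
apply: le_trans (deriv_lipschitz small) _; rewrite addrC addKr.
have M0 : 0 <= M by apply: le_trans (fM (z := a) _); rewrite ?nm_ge0 // subrr nm0.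
by rewrite ler_wpM2l ?ins // divr_ge0 ?mulr_ge0 ?exprn_ge0 ?(ltW r0).
Qed.

End Disc2.
End OneVariable.

(** * Bounded limits of holomorphic functions *)

Definition tends (R : realType) (F : normedModType R[i]) (u : nat -> F) (l : F) :=
  forall e : R, 0 < e -> exists n0, forall n, (n0 <= n)%N -> nm (u n - l) <= e.

Section Limits.
Variables (R : realType) (F : normedModType R[i]).
Local Notation C := R[i].
Implicit Types (u v : nat -> F) (l k : F).

Lemma tendsD u v l k : tends u l -> tends v k -> tends (fun n => u n + v n) (l + k).
Proof.
move=> ul vk e e0; have e2 : 0 < e / 2 by rewrite divr_gt0.
have [n1 P1] := ul _ e2; have [n2 P2] := vk _ e2.
exists (maxn n1 n2) => n; rewrite geq_max => /andP[/P1 a /P2 b].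
by rewrite opprD addrACA (splitr e); apply: le_trans (nmD _ _) (lerD _ _).
Qed.

Lemma tendsZ (c : C) u l : tends u l -> tends (fun n => c *: u n) (c *: l).
Proof.
move=> ul e e0; have c0 := nm_ge0 c.
have [n0 P] := ul (e / (nm c + 1)) ltac:(by rewrite divr_gt0 // ltr_wpDl).
exists n0 => n /P; rewrite -scalerBr nmZ ler_pdivlMr ?ltr_wpDl //.
by have := nm_ge0 (u n - l); nra.
Qed.

Lemma tends_cst l : tends (fun=> l) l.
Proof. by move=> e e0; exists 0%N => n _; rewrite subrr nm0 ltW. Qed.

Lemma tendsB u v l k : tends u l -> tends v k -> tends (fun n => u n - v n) (l - k).
Proof.
move=> ul /(tendsZ (-1)) vk; rewrite -scaleN1r.
have -> : (fun n => u n - v n) = (fun n => u n + (-1 : C) *: v n).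
  by apply/funext => n; rewrite scaleN1r.
exact: tendsD.
Qed.

Lemma tends_le u l (B : R) : tends u l -> (forall n, nm (u n) <= B) -> nm l <= B.
Proof.
move=> ul uB; apply/ler_addgt0Pr => e /ul[n P].
have := P n (leqnn n); rewrite nmBC => ln.
by rewrite -(subrK (u n) l) addrC; apply: le_trans (nmD _ _) (lerD _ _).
Qed.

Lemma tends_uniq u l k : tends u l -> tends u k -> l = k.
Proof.
move=> ul uk; apply/eqP; rewrite -subr_eq0; apply/eqP/nm_eq0/le_anti.
rewrite nm_ge0 andbT; apply: (tends_le (tendsB ul uk)) => n.
by rewrite subrr nm0.
Qed.

Lemma tends_small u l (c : R) : 0 <= c ->
  (forall n, nm (u n - l) <= c * 2^-1 ^+ n) -> tends u l.
Proof.
move=> c0 uP e e0.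
have [n0 P] := @pow2V_lt R (e / (c + 1)) ltac:(by rewrite divr_gt0 // ltr_wpDl).
exists n0 => n /P; rewrite ltr_pdivlMr ?ltr_wpDl // => pe; apply: le_trans (uP n) _.
have : (0 : R) <= 2^-1 ^+ n by rewrite exprn_ge0 // invr_ge0.
by nra.
Qed.

End Limits.

Section CompleteLimits.
Variables (R : realType) (F : completeNormedModType R[i]).

Lemma tends_geometric (u : nat -> F) (c : R) : 0 <= c ->
  (forall n, nm (u n.+1 - u n) <= c * 2^-1 ^+ n) -> exists l, tends u l.
Proof.
move=> c0 uP.
have far n k : nm (u (n + k)%N - u n) <= 2 * c * 2^-1 ^+ n.
  (* The subtracted power makes the bound inductive in [k]. *)
  suff : nm (u (n + k)%N - u n) <= 2 * c * (2^-1 ^+ n - 2^-1 ^+ (n + k)).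
    move=> /le_trans; apply; rewrite ler_wpM2l ?mulr_ge0 // gerBl.
    by rewrite exprn_ge0 // invr_ge0.
  elim: k => [|k IH]; first by rewrite addn0 !subrr nm0 mulr0.
  rewrite addnS -(subrK (u (n + k)%N) (u _)) -addrA.
  apply: le_trans (nmD _ _) _; apply: le_trans (lerD (uP _) IH) _.
  by rewrite exprS; lra.
apply: cauchy_lim => e e0.
have [n0 P] := @pow2V_lt R (e / (4 * c + 1)) ltac:(by rewrite divr_gt0 // ltr_wpDl ?mulr_ge0).
exists n0 => n k n0n n0k; have := P n0 (leqnn _).
rewrite ltr_pdivlMr ?ltr_wpDl ?mulr_ge0 // => pe.
have := far n0 (n - n0)%N; have := far n0 (k - n0)%N; rewrite !subnKC // => a b.
rewrite -(subrK (u n0) (u n)) -addrA; apply: le_trans (nmD _ _) _.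
rewrite nmBC in a; apply: le_trans (lerD b a) _.
have : (0 : R) <= 2^-1 ^+ n0 by rewrite exprn_ge0 // invr_ge0.
by nra.
Qed.

End CompleteLimits.

(** Radius and bound are carried together because every later constant is a function of these two,
    uniformly over families. *)
Definition bhol (R : realType) (V F : normedModType R[i]) (f : V -> F) (a : V) (r M : R) :=
  forall z, nm (z - a) < r -> differentiable f z /\ nm (f z) <= M.

Section BoundedHolomorphic.
Variables (R : realType) (V F : normedModType R[i]).
Local Notation C := R[i].
Implicit Types (f : V -> F) (a b v h : V) (r M : R).

Lemma bhol_ge0 f a r M : 0 < r -> bhol f a r M -> 0 <= M.
Proof.
move=> r0 fb; have [|_ fM] := fb a; first by rewrite subrr nm0.
exact: le_trans (nm_ge0 _) fM.
Qed.

Lemma bhol_sub f a r M b s : bhol f a r M -> nm (b - a) + s <= r -> bhol f b s M.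
Proof.
move=> fb bs z zb; apply: fb; rewrite -(subrK b z) -addrA.
by apply: le_lt_trans (nmD _ _) _; lra.
Qed.

Lemma bhol_slice f a r M v : bhol f a r M -> nm v <= 1 ->
  bhol (fun t : C^o => f (a + t *: v)) (0 : C^o) r M.
Proof.
move=> fb v1 t; rewrite subr0 => tr.
have [|df fM] := fb (a + t *: v).
  rewrite addrC addKr nmZ; apply: le_lt_trans tr.
  by rewrite ler_piMr ?nm_ge0.
by split=> //; have [] := differentiable_slice df.
Qed.

Lemma unit_dir h : h != 0 -> nm ((nm h)^-1%:C *: h) <= 1 /\
  h = (nm h)%:C *: ((nm h)^-1%:C *: h).
Proof.
move=> h0; have nh : 0 < nm h.
  by rewrite lt_neqAle nm_ge0 andbT eq_sym; apply: contra_neq h0 => /nm_eq0.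
have nz : nm h != 0 by rewrite gt_eqF.
split; first by rewrite nmZ nmR ger0_norm ?invr_ge0 ?nm_ge0 // mulVf.
by rewrite scalerA -CM mulfV // rmorph1 scale1r.
Qed.

Lemma dd_bound f a r M h : 0 < r -> bhol f a r M ->
  nm (dd f a h) <= 4 * M / r * nm h.
Proof.
move=> r0 fb; have [->|h0] := eqVneq h 0; first by rewrite linear0 !nm0 mulr0.
have [u1 hE] := unit_dir h0; set u := _ *: h in u1 hE.
rewrite {1}hE linearZ /= nmZ nmR ger0_norm ?nm_ge0 // mulrC ler_wpM2r ?nm_ge0 //.
have fs := bhol_slice fb u1.
have da : differentiable f (a + 0 *: u).
  by rewrite scale0r addr0; have [] := fb a; rewrite ?subrr ?nm0.
have [_ E] := differentiable_slice da.
rewrite scale0r addr0 in E; rewrite -E; apply: deriv_bound => // z /fs[] //.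
Qed.

Lemma taylor2 f a r M h : 0 < r -> bhol f a r M -> nm h < r / 4 ->
  nm (f (a + h) - f a - dd f a h) <= 64 * M / r ^+ 2 * nm h ^+ 2.
Proof.
move=> r0 fb; have [-> _|h0 hr] := eqVneq h 0.
  by rewrite addr0 subrr linear0 subr0 !nm0 expr0n mulr0.
have [u1 hE] := unit_dir h0; set u := _ *: h in u1 hE.
have fs := bhol_slice fb u1.
have da : differentiable f (a + 0 *: u).
  by rewrite scale0r addr0; have [] := fb a; rewrite ?subrr ?nm0.
have [_ E] := differentiable_slice da.
rewrite scale0r addr0 in E.
have nn : nm ((nm h)%:C : C^o) = nm h by rewrite nmR ger0_norm ?nm_ge0.
have := @taylor2_disc R F _ 0 r M r0 (fun z zr => (fs z zr).1) (fun z zr => (fs z zr).2)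
  ((nm h)%:C : C^o).
rewrite nn => /(_ hr); rewrite (diff_scalar _ 0 (nm h)%:C) E.
have -> : dd f a h = (nm h)%:C *: dd f a u by rewrite {1}hE linearZ.
by rewrite /= add0r scale0r addr0 -hE.
Qed.

End BoundedHolomorphic.

Section Vitali.
Variables (R : realType) (V : normedModType R[i]) (F : completeNormedModType R[i]).
Local Notation C := R[i].

(* By [taylor2] the difference quotients converge uniformly in n, so the
   derivatives of the f_n converge too. *)
Theorem bhol_tends (fs : nat -> V -> F) (f : V -> F) (a : V) (r M : R) :
  (forall n, bhol (fs n) a r M) ->
  (forall z, nm (z - a) < r -> tends (fun n => fs n z) (f z)) ->
  bhol f a r M.
Proof.
move=> fsb fst b ba; split; last first.
  by apply: (tends_le (fst b ba)) => n; have [] := fsb n b ba.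
pose s := r - nm (b - a).
have s0 : 0 < s by rewrite subr_gt0.
have fsb' n : bhol (fs n) b s M by apply: bhol_sub (fsb n) _; rewrite /s; lra.
have M0 := bhol_ge0 s0 (fsb' 0%N).
pose K := 64 * M / s ^+ 2.
have K0 : 0 <= K by rewrite divr_ge0 ?mulr_ge0 ?exprn_ge0 ?(ltW s0).
have inb h : nm h < s -> nm (b + h - a) < r.
  by move=> hs; rewrite addrAC; apply: le_lt_trans (nmD _ _) _; rewrite /s in hs; lra.
have L_ex h : exists l, tends (fun n => dd (fs n) b h) l.
  apply: cauchy_lim => e e0; pose c := nm h; have c0 : 0 <= c := nm_ge0 h.
  (* The step [t] is fixed before n and k, so that the Taylor remainder along t h is at most t e / 8
     for all members of the sequence at once. Only then are n and k taken so large that the values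
     at both points are within t e / 16 of their limits. The total is t e / 2, and dividing by t
     gives the Cauchy estimate. *)
  pose t := Num.min (s / (8 * (c + 1))) (e / (8 * (K * c ^+ 2 + 1))).
  have q0 : 0 < K * c ^+ 2 + 1 by rewrite ltr_wpDl // mulr_ge0 // exprn_ge0.
  have c1 : 0 < c + 1 by rewrite ltr_wpDl.
  have t0 : 0 < t by rewrite lt_min !divr_gt0 ?mulr_gt0.
  have : t <= s / (8 * (c + 1)) by rewrite ge_min lexx.
  rewrite ler_pdivlMr ?mulr_gt0 // => ts.
  have : t <= e / (8 * (K * c ^+ 2 + 1)) by rewrite ge_min lexx orbT.
  rewrite ler_pdivlMr ?mulr_gt0 // => te.
  have nt : nm (t%:C *: h) = t * c by rewrite nmZ nmR ger0_norm // ltW.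
  have tc : t * c < s / 4 by nra.
  have te0 : 0 < t * e / 16 by rewrite divr_gt0 // mulr_gt0.
  have [|n1 P1] := fst (b + t%:C *: h) _ _ te0; first by apply: inb; rewrite nt; lra.
  have [n2 P2] := fst b ba _ te0.
  exists (maxn n1 n2) => n k; rewrite !geq_max => /andP[n1n n2n] /andP[n1k n2k].
  have tay i := taylor2 s0 (fsb' i) (h := t%:C *: h) ltac:(by rewrite nt).
  have DE i : dd (fs i) b (t%:C *: h) = t%:C *: dd (fs i) b h by rewrite linearZ.
  have := tay n; have := tay k; rewrite -/K nt !DE.
  have := P1 n n1n; have := P1 k n1k; have := P2 n n2n; have := P2 k n2k.
  set A := fs n (_ + _); set B := fs k (_ + _); set A' := fs n b; set B' := fs k b.
  set X := f (_ + _); set Y := f b; set D := dd (fs n) b h; set D' := dd (fs k) b h.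
  move=> p1 p2 p3 p4 p5 p6.
  rewrite -(ler_pM2l t0) -{1}(ger0_norm (ltW t0)) -nmR -nmZ.
  have -> : t%:C *: (D - D') = ((B - B' - t%:C *: D') - (A - A' - t%:C *: D)) +
      (((A - X) - (B - X)) - ((A' - Y) - (B' - Y))).
    by clearbody A B A' B' X Y D D'; mod_eq R[i].
  apply: le_trans (nmD _ _) _.
  have := nmB (B - B' - t%:C *: D') (A - A' - t%:C *: D).
  have := nmB ((A - X) - (B - X)) ((A' - Y) - (B' - Y)).
  have := nmB (A - X) (B - X); have := nmB (A' - Y) (B' - Y).
  move: p1 p2 p3 p4 p5 p6.
  have : K * (t * c) ^+ 2 <= t * (e / 8).
    have -> : K * (t * c) ^+ 2 = t * (t * (K * c ^+ 2)) by ring.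
    by rewrite ler_wpM2l // ?ltW //; lra.
  move=> ? ? ? ? ? ? ? ? ? ? ?; lra.
have /choice[L LP] := L_ex.
apply: (@diff_intro R V F f b L (4 * M / s) _ _ _).1.
- move=> k x y; apply: tends_uniq (LP _) _.
  have -> : (fun n => dd (fs n) b (k *: x + y)) =
            (fun n => k *: dd (fs n) b x + dd (fs n) b y).
    by apply/funext => n; rewrite linearP.
  by apply: tendsD => //; apply: tendsZ.
- by move=> h; apply: (tends_le (LP h)) => n; exact: dd_bound.
move=> e e0; exists (Num.min (s / 4) (e / (K + 1))).
  by rewrite lt_min !divr_gt0 // ltr_wpDl.
move=> h; rewrite lt_min => /andP[hs]; rewrite ltr_pdivlMr ?ltr_wpDl // => hK.
have hs' : nm h < s by lra.
have T := tendsB (tendsB (fst _ (inb h hs')) (fst b ba)) (LP h).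
apply: le_trans (tends_le T (fun n => taylor2 s0 (fsb' n) hs)) _.
by rewrite -/K; have := nm_ge0 h; nra.
Qed.

End Vitali.

(** * Hadamard's lemma *)

Section DerivativeHolomorphic.
Variables (R : realType) (V : normedModType R[i]) (F : completeNormedModType R[i]).
Local Notation C := R[i].
Implicit Types (f : V -> F) (a v z : V) (r M : R).

Lemma differentiable_cscale f (c : C) z :
  differentiable f z -> differentiable (fun w => c *: f w) z.
Proof. exact: (differentiable_scale (k := fun=> c) (differentiable_cst _ _)). Qed.

Lemma differentiable_affine f a (c : C) (b : V) z :
  differentiable f (a + c *: (z - b)) ->
  differentiable (fun w => f (a + c *: (w - b))) z.
Proof.
by move=> df; apply: (@differentiable_comp _ _ _ _ (fun w => a + c *: (w - b)) f).
Qed.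

(** The difference quotients with steps [t n] are holomorphic in z and converge by [taylor2], so
    [bhol_tends] applies. In the constant, 40 = 32 + 8: the quadratic remainder contributes 32, and
    [dd_bound] on balls of radius r/2 contributes 8. *)
Lemma dd_bhol f a r M v : 0 < r -> bhol f a r M ->
  bhol (fun z => dd f z v) a (r / 2) (40 * M / r * nm v).
Proof.
move=> r0 fb; have M0 := bhol_ge0 r0 fb.
pose c := nm v; have c0 : 0 <= c := nm_ge0 v.
have c1 : 0 < c + 1 by rewrite ltr_wpDl.
(* The increments t v then stay within r/16, safely below the r/8 that [taylor2] allows on balls of
   radius r/2. *)
pose T := r / (16 * (c + 1)).
have T0 : 0 < T by rewrite divr_gt0 ?mulr_gt0.
have Tc : T * c <= r / 16.
  have -> : r / 16 = T * (c + 1) by rewrite /T; field; rewrite gt_eqF.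
  by rewrite ler_wpM2l ?(ltW T0) // lerDl.
pose t n := 2^-1 ^+ n * T.
have t0 n : 0 < t n by rewrite mulr_gt0 // exprn_gt0 // invr_gt0.
have tT n : t n <= T.
  by rewrite ler_piMl ?(ltW T0) // exprn_ile1 ?invr_ge0 // invf_le1 // ler1n.
have nt n : nm ((t n)%:C *: v) = t n * c by rewrite nmZ nmR ger0_norm ?(ltW (t0 n)).
have tc n : t n * c <= r / 16 by apply: le_trans Tc; rewrite ler_wpM2r.
have tc8 n : t n * c <= r / 8 by have := tc n; lra.
have r2 : 0 < r / 2 by rewrite divr_gt0.
have fz z : nm (z - a) < r / 2 -> bhol f z (r / 2) M.
  by move=> za; apply: bhol_sub fb _; lra.
pose K := 256 * M / r ^+ 2.
have K0 : 0 <= K by rewrite divr_ge0 ?mulr_ge0 ?exprn_ge0 ?(ltW r0).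
have KE : 64 * M / (r / 2) ^+ 2 = K by rewrite /K; field; rewrite gt_eqF.
have tay z n : nm (z - a) < r / 2 ->
    nm (f (z + (t n)%:C *: v) - f z - dd f z ((t n)%:C *: v)) <= K * (t n * c) ^+ 2.
  move=> /fz fzb; rewrite -KE -nt; apply: taylor2 => //.
  by rewrite nt; have := tc n; lra.
have tinv n : (t n)^-1%:C * (t n)%:C = 1 :> C by rewrite -CM mulVf ?gt_eqF.
have nti n : nm ((t n)^-1%:C : C) = (t n)^-1 by rewrite nmR ger0_norm // invr_ge0 ltW.
apply: (@bhol_tends _ _ _ (fun n z => (t n)^-1%:C *: (f (z + (t n)%:C *: v) - f z))).
- move=> n z za; have fzb := fz z za; split.
    apply: differentiable_cscale; apply: differentiableB; last first.
      by have [] := fzb z; rewrite ?subrr ?nm0.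
    have -> : (fun w => f (w + (t n)%:C *: v)) =
        (fun w => f ((t n)%:C *: v + 1 *: (w - 0))).
      by apply/funext => w; rewrite scale1r subr0 addrC.
    apply: differentiable_affine; rewrite scale1r subr0 addrC.
    have [] // := fzb (z + (t n)%:C *: v).
    by rewrite addrC addKr nt; have := tc n; lra.
  rewrite nmZ nti mulrC ler_pdivrMr // -(subrK (dd f z ((t n)%:C *: v)) (_ - _)).
  apply: le_trans (nmD _ _) _.
  apply: le_trans (lerD (tay z n za) (dd_bound _ r2 fzb)) _.
  rewrite nt -/c.
  have -> : 40 * M / r * c * t n = K * (t n * c) * (r / 8) + 4 * M / (r / 2) * (t n * c).
    by rewrite /K; field; rewrite gt_eqF.
  rewrite lerD2r expr2 (mulrA K (t n * c) (t n * c)) ler_wpM2l //.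
  by apply: mulr_ge0 => //; apply: mulr_ge0 => //; exact/ltW/t0.
move=> z za; apply: (tends_small (c := K * c ^+ 2 * T)).
  by apply: mulr_ge0; [apply: mulr_ge0 => //; exact: exprn_ge0|exact: ltW].
move=> n; have -> : (t n)^-1%:C *: (f (z + (t n)%:C *: v) - f z) - dd f z v =
    (t n)^-1%:C *: (f (z + (t n)%:C *: v) - f z - dd f z ((t n)%:C *: v)).
  have -> : dd f z ((t n)%:C *: v) = (t n)%:C *: dd f z v by rewrite linearZ.
  by rewrite [RHS]scalerBr scalerA tinv scale1r.
rewrite nmZ nti mulrC ler_pdivrMr //; apply: le_trans (tay z n za) _.
by rewrite le_eqVlt; apply/orP; left; apply/eqP; rewrite /t; ring.
Qed.

Lemma bhol_lipschitz f a r M x u : 0 < r -> bhol f a r M ->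
  nm (x - a) < r / 2 -> nm (x + u - a) < r / 2 ->
  nm (f (x + u) - f x) <= 8 * M / r * nm u.
Proof.
move=> r0 fb xa ya.
have inside (t : R) : 0 <= t <= 1 -> nm (x + t%:C *: u - a) < r / 2.
  move=> /andP[t0 t1].
  have -> : x + t%:C *: u - a = (1 - t)%:C *: (x - a) + t%:C *: (x + u - a).
    by rewrite CB; mod_eq R[i].
  apply: le_lt_trans (nmD _ _) _; rewrite !nmZ !nmR !ger0_norm ?subr_ge0 //.
  by have [AB|/ltW AB] := leP (nm (x - a)) (nm (x + u - a));
    [apply: le_lt_trans ya|apply: le_lt_trans xa]; nra.
have rr : r / 2 < r by lra.
apply: mean_value_inequality => t /inside ta.
  by have [] := fb _ (lt_trans ta rr).
have -> : 8 * M / r = 4 * M / (r / 2) by field; rewrite gt_eqF.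
by apply: dd_bound; rewrite ?divr_gt0 //; apply: bhol_sub fb _; lra.
Qed.

End DerivativeHolomorphic.

Section Average.
Variables (R : realType) (F : normedModType R[i]).
Local Notation C := R[i].
Implicit Types (psi phi : R -> F) (x d : R).

(* The dyadic Riemann sum for the mean of psi over [x, x + d]. *)
Fixpoint avg psi N x d : F :=
  if N is n.+1 then (2^-1 : C) *: (avg psi n x (d / 2) + avg psi n (x + d / 2) (d / 2))
  else psi x.

Lemma avg_cauchy psi (L : R) :
  (forall x d, 0 <= x -> 0 <= d -> x + d <= 1 -> nm (psi (x + d) - psi x) <= L * d) ->
  forall N x d, 0 <= x -> 0 <= d -> x + d <= 1 ->
  nm (avg psi N.+1 x d - avg psi N x d) <= L * d * 2^-1 ^+ N.
Proof.
move=> psiL; elim=> [|N IH] x d x0 d0 xd.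
  have p1 := psiL x (d / 2) x0 ltac:(lra) ltac:(lra).
  have -> : avg psi 1 x d - avg psi 0 x d = (2^-1 : C) *: (psi (x + d / 2) - psi x).
    by rewrite /=; mod_eq R[i].
  rewrite nmZ nm2V expr0 mulr1.
  by have := nm_ge0 (psi (x + d / 2) - psi x); lra.
have h1 := IH x (d / 2) x0 ltac:(lra) ltac:(lra).
have h2 := IH (x + d / 2) (d / 2) ltac:(lra) ltac:(lra) ltac:(lra).
have -> : avg psi N.+2 x d - avg psi N.+1 x d =
  (2^-1 : C) *: ((avg psi N.+1 x (d / 2) - avg psi N x (d / 2)) +
  (avg psi N.+1 (x + d / 2) (d / 2) - avg psi N (x + d / 2) (d / 2))).
  rewrite [avg psi N.+2 x d]/= [in LHS](_ : avg psi N.+1 x d = (2^-1 : C) *: (avg psi N x (d / 2) + avg psi N (x + d / 2) (d / 2))) //.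
  by rewrite -scalerBr opprD addrACA.
rewrite nmZ nm2V; apply: le_trans (ler_wpM2l _ (nmD _ _)) _; first by rewrite invr_ge0.
by rewrite exprS; lra.
Qed.

(** The fundamental theorem of calculus for Riemann sums: each of the 2^N pieces, of length d / 2^N,
    contributes an error of at most K (d / 2^N)^2. *)
Lemma avg_ftc phi psi (K : R) :
  (forall x d, 0 <= x -> 0 <= d -> x + d <= 1 ->
     nm (phi (x + d) - phi x - d%:C *: psi x) <= K * d ^+ 2) ->
  forall N x d, 0 <= x -> 0 <= d -> x + d <= 1 ->
  nm (phi (x + d) - phi x - d%:C *: avg psi N x d) <= K * d ^+ 2 * 2^-1 ^+ N.
Proof.
move=> phiK; elim=> [|N IH] x d x0 d0 xd; first by rewrite expr0 mulr1 phiK.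
have h1 := IH x (d / 2) x0 ltac:(lra) ltac:(lra).
have h2 := IH (x + d / 2) (d / 2) ltac:(lra) ltac:(lra) ltac:(lra).
have xE : x + d / 2 + d / 2 = x + d by field.
rewrite xE in h2.
have -> : phi (x + d) - phi x - d%:C *: avg psi N.+1 x d =
  (phi (x + d / 2) - phi x - (d / 2)%:C *: avg psi N x (d / 2)) +
  (phi (x + d) - phi (x + d / 2) - (d / 2)%:C *: avg psi N (x + d / 2) (d / 2)).
  rewrite /= CM C2V; move: (phi _) (phi x) (phi (x + d / 2)) (avg _ _ _ _) (avg _ _ _ _).
  by move=> A B D X Y; mod_eq R[i].
apply: le_trans (nmD _ _) _; rewrite (exprS _ N); apply: le_trans (lerD h1 h2) _.
have : 0 <= d ^+ 2 * 2^-1 ^+ N by rewrite mulr_ge0 ?exprn_ge0 // invr_ge0.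
by move: (2^-1 ^+ N) => q; lra.
Qed.

Lemma avg_linear psi psi' (k : C) N x d :
  avg (fun y => k *: psi y + psi' y) N x d = k *: avg psi N x d + avg psi' N x d.
Proof.
elim: N x d => [//|N IH] x d /=; rewrite !IH.
by move: (avg _ _ _ _) (avg _ _ _ _) (avg _ _ _ _) (avg _ _ _ _) => A B D E; mod_eq R[i].
Qed.

Lemma avg_bhol (V : normedModType R[i]) (psi : V -> R -> F) a r (M : R) :
  (forall x, 0 <= x <= 1 -> bhol (fun z => psi z x) a r M) ->
  forall N x d, 0 <= x -> 0 <= d -> x + d <= 1 -> bhol (fun z => avg (psi z) N x d) a r M.
Proof.
move=> psib; elim=> [|N IH] x d x0 d0 xd; first by apply: psib; apply/andP; split; lra.
move=> z za.
have [d1 b1] := IH x (d / 2) x0 ltac:(lra) ltac:(lra) z za.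
have [d2 b2] := IH (x + d / 2) (d / 2) ltac:(lra) ltac:(lra) ltac:(lra) z za.
split=> /=.
  apply: (differentiable_scale (k := fun=> (2^-1 : C))); first exact: differentiable_cst.
  exact: differentiableD.
by rewrite nmZ nm2V; have := nmD (avg (psi z) N x (d / 2)) (avg (psi z) N (x + d / 2) (d / 2)); lra.
Qed.

End Average.

Section Hadamard.
Variables (R : realType) (V : normedModType R[i]) (F : completeNormedModType R[i]).
Local Notation C := R[i].

(* [G v z] is the mean of [dd f (a + t (z - a)) v] over [0 <= t <= 1]. *)
Theorem hadamard (f : V -> F) a r M : 0 < r -> bhol f a r M ->
  exists G : V -> V -> F,
  [/\ forall v, bhol (G v) a (r / 8) (40 * M / r * nm v),
      forall z k v w, nm (z - a) < r / 8 -> G (k *: v + w) z = k *: G v z + G w z &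
      forall z, nm (z - a) < r / 8 -> f z = f a + G (z - a) z].
Proof.
move=> r0 fb; have M0 := bhol_ge0 r0 fb.
pose psi v z (x : R) := dd f (a + x%:C *: (z - a)) v.
have r2 : 0 < r / 2 by rewrite divr_gt0.
have pin z (x : R) s : nm (z - a) < s -> 0 <= x <= 1 -> nm (a + x%:C *: (z - a) - a) < s.
  move=> zs /andP[x0 x1]; rewrite addrC addKr nmZ nmR ger0_norm //.
  by apply: le_lt_trans zs; rewrite ler_piMl ?nm_ge0.
have lip v z : nm (z - a) < r / 8 -> exists2 L : R, 0 <= L & forall x d,
    0 <= x -> 0 <= d -> x + d <= 1 -> nm (psi v z (x + d) - psi v z x) <= L * d.
  move=> za; exists (8 * (40 * M / r * nm v) / (r / 2) * nm (z - a)).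
    by do ![apply: divr_ge0|apply: mulr_ge0|exact: nm_ge0|exact: ltW|by []].
  move=> x d x0 d0 xd; rewrite /psi.
  have -> : a + (x + d)%:C *: (z - a) = a + x%:C *: (z - a) + d%:C *: (z - a).
    by rewrite CD scalerDl addrA.
  have -> : 8 * (40 * M / r * nm v) / (r / 2) * nm (z - a) * d =
    8 * (40 * M / r * nm v) / (r / 2) * nm (d%:C *: (z - a)).
    by rewrite nmZ nmR ger0_norm // -mulrA (mulrC d).
  apply: (bhol_lipschitz r2 (dd_bhol v r0 fb)).
    by apply: pin; [lra|apply/andP; split; lra].
  rewrite (_ : a + _ + _ = a + (x + d)%:C *: (z - a)); last by rewrite CD scalerDl addrA.
  by apply: pin; [lra|apply/andP; split; lra].
have G_ex (p : V * V) : exists l, nm (p.2 - a) < r / 8 ->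
    tends (fun N => avg (psi p.1 p.2) N 0 1) l.
  have [za|za] := pselect (nm (p.2 - a) < r / 8); last by exists 0.
  have [L L0 LP] := lip p.1 p.2 za.
  have [|l lP] := @tends_geometric R F (fun N => avg (psi p.1 p.2) N 0 1) L L0; last by exists l.
  move=> n; have := avg_cauchy LP n (x := 0) (d := 1) (lexx _) ler01.
  by rewrite add0r mulr1; apply.
have /choice[G0 GP] := G_ex.
exists (fun v z => G0 (v, z)); split.
- move=> v; apply: (@bhol_tends _ _ _ (fun N z => avg (psi v z) N 0 1)).
    move=> N; apply: avg_bhol; rewrite ?lexx ?ler01 ?add0r //.
    move=> x x01 z za; have [|dg gM] := @dd_bhol _ _ _ f a r M v r0 fb (a + x%:C *: (z - a)).
      by apply: pin => //; lra.
    by split=> //; apply: (@differentiable_affine R V F (fun w => dd f w v)).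
  by move=> z za; exact: (GP (v, z)).
- move=> z k v w za; apply: tends_uniq (GP (k *: v + w, z) za) _.
  have -> : (fun N => avg (psi (k *: v + w) z) N 0 1) =
     (fun N => k *: avg (psi v z) N 0 1 + avg (psi w z) N 0 1).
    apply/funext => N; rewrite -avg_linear; congr (avg _ _ _ _).
    by apply/funext => x; rewrite /psi dd_linear.
  by apply: tendsD; [apply: tendsZ; exact: (GP (v, z))|exact: (GP (w, z))].
move=> z za; apply/eqP; rewrite addrC -subr_eq; apply/eqP; apply: tends_uniq (GP (z - a, z) za).
pose K := 64 * M / (r / 2) ^+ 2 * nm (z - a) ^+ 2.
apply: (tends_small (c := K)).
  by do ![apply: divr_ge0|apply: mulr_ge0|apply: exprn_ge0|exact: nm_ge0|exact: ltW|by []].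
have ftc x d : 0 <= x -> 0 <= d -> x + d <= 1 ->
    nm (f (a + (x + d)%:C *: (z - a)) - f (a + x%:C *: (z - a)) -
        d%:C *: psi (z - a) z x) <= K * d ^+ 2.
  move=> x0 d0 xd; rewrite /psi.
  have -> : a + (x + d)%:C *: (z - a) = a + x%:C *: (z - a) + d%:C *: (z - a).
    by rewrite CD scalerDl addrA.
  have -> : d%:C *: dd f (a + x%:C *: (z - a)) (z - a) =
      dd f (a + x%:C *: (z - a)) (d%:C *: (z - a)) by rewrite linearZ.
  have nd : nm (d%:C *: (z - a)) = nm (z - a) * d by rewrite nmZ nmR ger0_norm // mulrC.
  have -> : K * d ^+ 2 = 64 * M / (r / 2) ^+ 2 * nm (d%:C *: (z - a)) ^+ 2.
    by rewrite nd /K; ring.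
  (* Here the ball of radius r/2 about a point of the segment is used; [taylor2] wants increments
     below a quarter of that radius, whence the r/8 of the statement. *)
  apply: taylor2 => //; last first.
    by rewrite nd; have := ler_piMr (nm_ge0 (z - a)) (ltac:(lra) : d <= 1); lra.
  apply: bhol_sub fb _.
  have := pin z x (r / 8) za ltac:(by apply/andP; split; lra); lra.
move=> N; have := avg_ftc ftc N (x := 0) (d := 1) (lexx _) ler01.
rewrite add0r expr1n mulr1 => /(_ (lexx _)).
by rewrite rmorph1 rmorph0 !scale1r scale0r addr0 (addrC a) subrK nmBC.
Qed.

End Hadamard.

(** * Taylor coefficients along lines *)

Section Expansion.
Variables (R : realType) (F : normedModType R[i]).
Local Notation C := R[i].
Implicit Types (phi : C^o -> F) (b : nat -> F).

(* phi has the asymptotic expansion sum_j t^j b_j at 0, to every order. *)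
Definition has_exp phi b := forall k, exists B d : R, 0 < d /\
  forall t : C^o, 0 < nm t -> nm t < d ->
    nm (phi t - \sum_(0 <= j < k) (t : C) ^+ j *: b j) <= B * nm t ^+ k.

Lemma has_expD phi phi' b b' : has_exp phi b -> has_exp phi' b' ->
  has_exp (fun t => phi t + phi' t) (fun j => b j + b' j).
Proof.
move=> e1 e2 k; have [B1 [d1 [d10 P1]]] := e1 k; have [B2 [d2 [d20 P2]]] := e2 k.
exists (B1 + B2), (Num.min d1 d2); split; first by rewrite lt_min d10.
move=> t t0; rewrite lt_min => /andP[/(P1 t t0) a1 /(P2 t t0) a2].
rewrite (_ : \sum_(0 <= j < k) _ = \sum_(0 <= j < k) (t : C) ^+ j *: b j +
  \sum_(0 <= j < k) (t : C) ^+ j *: b' j); last first.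
  by rewrite -big_split; apply: eq_bigr => i _; rewrite scalerDr.
by rewrite opprD addrACA mulrDl; apply: le_trans (nmD _ _) (lerD _ _).
Qed.

Lemma has_expZ (c : C) phi b : has_exp phi b ->
  has_exp (fun t => c *: phi t) (fun j => c *: b j).
Proof.
move=> e1 k; have [B [d [d0 P]]] := e1 k; exists (nm c * B), d; split=> // t t0 /(P t t0) a.
rewrite (_ : \sum_(0 <= j < k) _ = c *: \sum_(0 <= j < k) (t : C) ^+ j *: b j); last first.
  by rewrite scaler_sumr; apply: eq_bigr => i _; rewrite !scalerA mulrC.
by rewrite -scalerBr nmZ -mulrA ler_wpM2l ?nm_ge0.
Qed.

Lemma has_exp_shift phi b : has_exp phi b ->
  has_exp (fun t => (t : C) *: phi t) (fun j => if j is i.+1 then b i else 0).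
Proof.
move=> e1 [|k].
  (* Order 0 asserts mere boundedness near 0; cutting the radius to 1 makes multiplication by t
     harmless. *)
  have [B [d [d0 P]]] := e1 0%N; exists (B * 1), (Num.min d 1).
  split; first by rewrite lt_min d0 ltr01.
  move=> t t0; rewrite lt_min => /andP[/(P t t0)]; rewrite !big_nil !subr0 !expr0 nmZ.
  by have := nm_ge0 (phi t); nra.
have [B [d [d0 P]]] := e1 k; exists B, d; split=> // t t0 /(P t t0) a.
rewrite big_nat_recl // scaler0 add0r.
rewrite (_ : \sum_(0 <= j < k) _ = (t : C) *: \sum_(0 <= j < k) (t : C) ^+ j *: b j); last first.
  by rewrite scaler_sumr; apply: eq_bigr => i _; rewrite exprS scalerA.
by rewrite -scalerBr nmZ exprS mulrCA ler_wpM2l ?nm_ge0.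
Qed.

Lemma has_exp_rescale (s : C) phi b : s != 0 -> has_exp phi b ->
  has_exp (fun t => phi (s * t)) (fun j => s ^+ j *: b j).
Proof.
move=> s0 e1 k; have [B [d [d0 P]]] := e1 k; have ns := nm_gt0 s0.
exists (B * nm s ^+ k), (d / nm s); split; first by rewrite divr_gt0.
move=> t t0; rewrite ltr_pdivlMr // mulrC -nmM => td.
have := P (s * t) _ td; rewrite nmM mulr_gt0 // => /(_ isT).
rewrite exprMn mulrA; apply: le_trans; rewrite le_eqVlt; apply/orP; left; apply/eqP.
congr (nm (_ - _)); apply: eq_bigr => i _.
by rewrite scalerA exprMn mulrC.
Qed.

Lemma has_exp_near phi phi' b (d : R) : 0 < d ->
  (forall t : C^o, nm t < d -> phi t = phi' t) -> has_exp phi b -> has_exp phi' b.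
Proof.
move=> d0 E e1 k; have [B [d' [d'0 P]]] := e1 k; exists B, (Num.min d d').
split; first by rewrite lt_min d0.
by move=> t t0; rewrite lt_min => /andP[/E <- /(P t t0)].
Qed.

(** Identities between Taylor coefficients are obtained by comparing two expansions of one function,
    without rearranging convergent series. If the coefficients below j agree, subtracting the
    expansions of order j+1 leaves s^j (b_j - b'_j) = O(s^(j+1)). *)
Lemma has_exp_uniq phi b b' : has_exp phi b -> has_exp phi b' -> b = b'.
Proof.
move=> e1 e2; apply/funext => j; elim/ltn_ind: j => j IH.
have [B1 [d1 [d10 P1]]] := e1 j.+1; have [B2 [d2 [d20 P2]]] := e2 j.+1.
apply/eqP; rewrite -subr_eq0; apply/eqP/nm_small => e e0.
(* The constants in [has_exp] carry no sign; the added 1 makes [B] a legitimate divisor. *)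
pose B := `|B1| + `|B2| + 1.
have B0 : 0 < B by rewrite ltr_wpDl ?addr_ge0.
pose s := Num.min (Num.min d1 d2) (e / B) / 2.
have s0 : 0 < s by rewrite divr_gt0 // !lt_min d10 d20 divr_gt0.
have : s * 2 <= Num.min (Num.min d1 d2) (e / B) by rewrite divfK.
rewrite !le_min => /andP[/andP[sd1 sd2]]; rewrite ler_pdivlMr // => sB.
have ns : nm (s%:C : C^o) = s by rewrite nmR gtr0_norm.
have := P1 s%:C; have := P2 s%:C; rewrite ns => /(_ s0 ltac:(lra)) a2 /(_ s0 ltac:(lra)) a1.
rewrite big_nat_recr //= in a1; rewrite big_nat_recr //= in a2.
rewrite (_ : \sum_(0 <= i < j) _ = \sum_(0 <= i < j) (s%:C : C) ^+ i *: b i) in a2; last first.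
  by apply: eq_big_nat => i /andP[_ ij]; rewrite IH.
have sj : 0 < s ^+ j by rewrite exprn_gt0.
rewrite -(ler_pM2l sj) -{1}ns -nmX -nmZ.
move: (\sum_(0 <= i < j) _) (phi _) a1 a2 => S p a1 a2.
have -> : (s%:C : C) ^+ j *: (b j - b' j) = (p - (S + (s%:C : C) ^+ j *: b' j)) -
  (p - (S + (s%:C : C) ^+ j *: b j)) by mod_eq R[i].
apply: le_trans (nmB _ _) _; apply: le_trans (lerD a2 a1) _.
rewrite exprS.
have q2 := ler_wpM2r (mulr_ge0 (ltW s0) (ltW sj)) (ler_norm B2).
have q1 := ler_wpM2r (mulr_ge0 (ltW s0) (ltW sj)) (ler_norm B1).
have : s ^+ j * (s * B) <= s ^+ j * e by rewrite ler_wpM2l ?(ltW sj) //; nra.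
have : 0 <= s * s ^+ j by rewrite mulr_ge0 // ltW.
by rewrite /B; lra.
Qed.

End Expansion.

Section Coefficients.
Variables (R : realType) (F : completeNormedModType R[i]).
Local Notation C := R[i].
Implicit Types (phi : C^o -> F).

(** The singularity at 0 is removable: off 0 the slope equals Hadamard's quotient [G 1], and both
    are continuous at 0. The bound comes from the Lipschitz estimate for |z| < r/2 and from |phi(z)
    - phi(0)| <= 2 M beyond. Since the radius is preserved, the operation can be iterated. *)
Lemma slope_bhol phi (r M : R) : 0 < r -> bhol phi 0 r M ->
  bhol (slope phi 0) 0 r (8 * M / r).
Proof.
move=> r0 pb; have M0 := bhol_ge0 r0 pb.
have d0 : differentiable phi (0 : C^o) by have [] := pb 0; rewrite ?subrr ?nm0.
have [G [Gb Glin GE]] := hadamard r0 pb.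
have r8 : 0 < r / 8 by rewrite divr_gt0.
have SG w : w != 0 -> nm w < r / 8 -> slope phi 0 w = G 1 w.
  move=> w0 wr; rewrite /slope (negPf w0) add0r GE ?subr0 //.
  have G00 z : nm (z - 0) < r / 8 -> G 0 z = 0.
    by move=> zr; have := Glin z (-1) 0 0 zr; rewrite scaleN1r oppr0 addr0 scaleN1r addNr.
  have wr' : nm (w - 0) < r / 8 by rewrite subr0.
  have wE : (w : C) *: (1 : C^o) + 0 = w by rewrite addr0; exact: mulr1.
  have := Glin w w 1 0 wr'; rewrite wE (G00 w wr') addr0 => ->.
  by rewrite addrC addKr scalerA mulVf // scale1r.
have G0 : slope phi 0 0 = G 1 0.
  apply/eqP; rewrite -subr_eq0; apply/eqP/nm_small => e e0.
  have e2 : 0 < e / 2 by rewrite divr_gt0.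
  have [d1 d10 P1] := slope_continuous d0 e2.
  have [|dG _] := Gb 1 0; first by rewrite subrr nm0.
  have [d2 d20 P2] := diff_continuous_nm dG e2.
  pose s := Num.min (Num.min d1 d2) (r / 8) / 2.
  have s0 : 0 < s by rewrite divr_gt0 // !lt_min d10 d20.
  have : s * 2 <= Num.min (Num.min d1 d2) (r / 8) by rewrite divfK.
  rewrite !le_min => /andP[/andP[sd1 sd2]] sr.
  have ns : nm (s%:C : C^o) = s by rewrite nmR gtr0_norm.
  have sn0 : (s%:C : C^o) != 0.
    by apply: contraTneq s0 => E; rewrite -ns E nm0 ltxx.
  have p1 := P1 s%:C ltac:(rewrite ns; lra).
  have p2 := P2 s%:C ltac:(rewrite subr0 ns; lra).
  have E := SG s%:C sn0 ltac:(rewrite ns; lra).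
  move: p1 p2; rewrite E; move: (slope phi 0 0) (G 1 0) (G 1 s%:C) => A B D p1 p2.
  have -> : A - B = (D - B) - (D - A) by mod_eq R[i].
  by rewrite (splitr e); apply: le_trans (nmB _ _) (lerD _ _).
move=> z; rewrite subr0 => zr; have [->|z0] := eqVneq z 0.
  split.
    apply: (@differentiable_near _ _ _ (G 1) _ (0 : C^o) (r / 8) r8).
      move=> w; rewrite subr0 => wr; have [->|w0] := eqVneq w 0; first by rewrite G0.
      by rewrite SG.
    by have [] := Gb 1 0; rewrite ?subrr ?nm0.
  have -> : slope phi 0 0 = dd phi 0 1 by rewrite /slope eqxx.
  have := dd_bound (1 : C^o) r0 pb; rewrite nm1 mulr1 => /le_trans; apply.
  by rewrite ler_wpM2r ?invr_ge0 ?(ltW r0) // ler_wpM2r // ler_nat.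
split; first by apply: differentiable_slope => //; rewrite add0r; have [] := pb z; rewrite ?subr0.
have nz := nm_gt0 z0.
rewrite /slope (negPf z0) add0r nmZ nmV mulrC ler_pdivrMr //.
have [zs|zb] := ltP (nm z) (r / 2).
  by have := @bhol_lipschitz _ _ _ phi 0 r M 0 z r0 pb; rewrite (add0r z) subrr nm0 subr0 divr_gt0 //; apply.
have [|_ bz] := pb z; first by rewrite subr0.
have [|_ b0] := pb 0; first by rewrite subr0 nm0.
apply: le_trans (nmB _ _) _; apply: le_trans (lerD bz b0) _.
rewrite mulrAC ler_pdivlMr //.
have := ler_wpM2l M0 zb; have := mulr_ge0 M0 (ltW nz); lra.
Qed.

(** The Taylor remainder of order k divided by t^k; its value at 0 is the k-th coefficient. *)
Definition Dq k phi : C^o -> F := iter k (fun g => slope g 0) phi.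

Lemma Dq_bhol phi (r M : R) k : 0 < r -> bhol phi 0 r M ->
  bhol (Dq k phi) 0 r (M * (8 / r) ^+ k).
Proof.
move=> r0 pb; elim: k => [|k IH]; first by rewrite expr0 mulr1.
by have := slope_bhol r0 IH; rewrite exprS; congr (bhol _ _ _ _); ring.
Qed.

Lemma slope_expand phi (t : C^o) : phi t = phi 0 + (t : C) *: slope phi 0 t.
Proof.
rewrite /slope; case: eqP => [->|/eqP t0]; first by rewrite scale0r addr0.
by rewrite add0r scalerA mulfV // scale1r addrC subrK.
Qed.

Lemma Dq_expand phi k (t : C^o) :
  phi t = \sum_(0 <= j < k) (t : C) ^+ j *: Dq j phi 0 + (t : C) ^+ k *: Dq k phi t.
Proof.
elim: k => [|k IH]; first by rewrite big_nil add0r expr0 scale1r.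
rewrite big_nat_recr //= -addrA {1}IH; congr (_ + _).
rewrite exprSr -scalerA -scalerDr; congr (_ *: _).
exact: (slope_expand (Dq k phi) t).
Qed.

Lemma bhol_has_exp phi (r M : R) : 0 < r -> bhol phi 0 r M ->
  has_exp phi (fun j => Dq j phi 0).
Proof.
move=> r0 pb k; exists (M * (8 / r) ^+ k), r; split=> // t t0 tr.
rewrite {1}(Dq_expand phi k t) addrC addKr nmZ nmX mulrC ler_wpM2r ?exprn_ge0 ?nm_ge0 //.
by have [] := Dq_bhol k r0 pb (z := t); rewrite ?subr0.
Qed.

(** Each order costs a factor 8/r in [Dq_bhol], so for |t| < r/16 the remainder is at most M
    2^-n. *)
Lemma Dq_sum phi (r M : R) (t : C^o) : 0 < r -> bhol phi 0 r M -> nm t < r / 16 ->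
  tends (fun n => \sum_(0 <= j < n) (t : C) ^+ j *: Dq j phi 0) (phi t).
Proof.
move=> r0 pb tr; apply: (tends_small (c := M)); first exact: bhol_ge0 pb.
move=> n; rewrite {1}(Dq_expand phi n t) opprD addrA subrr add0r nmN nmZ nmX.
have tr' : nm (t - 0) < r by rewrite subr0; lra.
have [_ b] := Dq_bhol n r0 pb tr'.
apply: le_trans (ler_wpM2l _ b) _; first by rewrite exprn_ge0 ?nm_ge0.
rewrite mulrCA ler_wpM2l ?(bhol_ge0 r0 pb) // -exprMn.
have t8 : 0 <= nm t * (8 / r) by rewrite mulr_ge0 ?nm_ge0 // divr_ge0 // ltW.
rewrite lerXn2r ?nnegrE ?invr_ge0 // mulrA ler_pdivrMr //; lra.
Qed.

End Coefficients.

Lemma differentiable_sum_nat (R : realType) (V F : normedModType R[i])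
  (g : nat -> V -> F) n z : (forall i, (i < n)%N -> differentiable (g i) z) ->
  differentiable (fun v => \sum_(0 <= i < n) g i v) z.
Proof.
elim: n => [|n IH] dg.
  under eq_fun do rewrite big_nil; exact: differentiable_cst.
under eq_fun do rewrite big_nat_recr //=.
by apply: differentiableD; [apply: IH => i ni; apply: dg; exact: ltnW|exact: dg].
Qed.

Section LineCoefficients.
Variables (R : realType) (V : normedModType R[i]) (F : completeNormedModType R[i]).
Local Notation C := R[i].
Implicit Types (f : V -> F) (a v : V).

(* The j-th Taylor coefficient of f along the line a + t v. *)
Definition lcoef f a v j : F := Dq j (fun t : C^o => f (a + (t : C) *: v)) 0.

Lemma lcoef_bound f a (r M : R) v j : 0 < r -> bhol f a r M -> nm v <= 1 ->
  nm (lcoef f a v j) <= M * (8 / r) ^+ j.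
Proof.
move=> r0 fb v1; have [] // := Dq_bhol j r0 (bhol_slice fb v1) (z := 0).
by rewrite subrr nm0.
Qed.

Lemma bhol_line f a (r M s : R) v : 0 < r -> bhol f a r M -> s * nm v <= r ->
  bhol (fun t : C^o => f (a + (t : C) *: v)) 0 s M.
Proof.
move=> r0 fb sv t; rewrite subr0 => ts.
have [|df fM] := fb (a + (t : C) *: v).
  rewrite addrC addKr nmZ; have := nm_ge0 v; rewrite le_eqVlt => /orP[/eqP <-|v0].
    by rewrite mulr0.
  by apply: lt_le_trans sv; rewrite ltr_pM2r.
by split=> //; have [] := differentiable_slice df.
Qed.

Lemma lcoef_has_exp f a (r M : R) v : 0 < r -> bhol f a r M ->
  has_exp (fun t : C^o => f (a + (t : C) *: v)) (lcoef f a v).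
Proof.
move=> r0 fb; have v0 := nm_ge0 v; have v1 : 0 < nm v + 1 by rewrite ltr_wpDl.
apply: (@bhol_has_exp R F _ (r / (nm v + 1)) M); first by rewrite divr_gt0.
apply: (bhol_line r0 fb); rewrite mulrAC ler_pdivrMr //.
by apply: ler_wpM2l; [exact: (ltW r0)|lra].
Qed.

(** By [Dq_expand], the j-th quotient at a nonzero parameter s_n is a combination of f(a + s_n v)
    and lower coefficients, so by induction it is holomorphic in v. Its bound does not depend on n,
    and letting s_n tend to 0 gives the coefficient through [bhol_tends]. *)
Lemma lcoef_bhol f a (r M : R) j : 0 < r -> bhol f a r M ->
  bhol (fun v => lcoef f a v j) 0 1 (M * (8 / r) ^+ j).
Proof.
move=> r0 fb; elim/ltn_ind: j => j IH.
pose s n := 2^-1 ^+ n * (r / 2).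
have s0 n : 0 < s n by rewrite mulr_gt0 ?divr_gt0 // exprn_gt0 // invr_gt0.
have sr n : s n < r.
  apply: (@le_lt_trans _ _ (1 * (r / 2))); last by lra.
  rewrite ler_wpM2r //; first by rewrite divr_ge0 // ltW.
  by rewrite exprn_ile1 ?invr_ge0 // invf_le1 // ler1n.
have ns n : nm ((s n)%:C : C^o) = s n by rewrite nmR gtr0_norm.
have sn0 n : ((s n)%:C : C) != 0.
  by apply: contraTneq (s0 n) => E; rewrite -ns E nm0 ltxx.
pose g n v := Dq j (fun t : C^o => f (a + (t : C) *: v)) (s n)%:C.
have gE n : g n = fun v => ((s n)%:C ^+ j)^-1 *: (f (a + (s n)%:C *: v) -
    \sum_(0 <= i < j) (s n)%:C ^+ i *: lcoef f a v i).
  apply/funext => v.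
  have := Dq_expand (fun t : C^o => f (a + (t : C) *: v)) j (s n)%:C.
  rewrite /= => ->; rewrite addrC addKr scalerA mulVf ?scale1r //.
  by rewrite expf_neq0.
apply: (@bhol_tends _ _ _ g) => [n v vb|v vb].
  have v1 : nm v <= 1 by move: vb; rewrite subr0 => /ltW.
  have [|_ gM] := Dq_bhol j r0 (bhol_slice fb v1) (z := (s n)%:C).
    by rewrite subr0 ns.
  split=> //; rewrite gE; apply: differentiable_cscale; apply: differentiableB.
    have -> : (fun v => f (a + (s n)%:C *: v)) = (fun v => f (a + (s n)%:C *: (v - 0))).
      by apply/funext => w; rewrite subr0.
    apply: differentiable_affine; rewrite subr0.
    have [] // := fb (a + (s n)%:C *: v); rewrite addrC addKr nmZ ns.
    by have := s0 n; have := sr n; nra.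
  apply: differentiable_sum_nat => i ij.
  by apply: differentiable_cscale; have [] := IH i ij v vb.
have v1 : nm v <= 1 by move: vb; rewrite subr0 => /ltW.
have [|dD _] := Dq_bhol j r0 (bhol_slice fb v1) (z := 0); first by rewrite subrr nm0.
move=> e /(diff_continuous_nm dD)[d d0 P].
have [n0 nP] := @pow2V_lt R (d / r) ltac:(by rewrite divr_gt0).
exists n0 => n /nP; rewrite ltr_pdivlMr // => sd; apply: P.
rewrite subr0 ns /s; have : (0 : R) < 2^-1 ^+ n by rewrite exprn_gt0 // invr_gt0.
by nra.
Qed.

Lemma lcoef_homog f a (r M : R) v (c : C) j : 0 < r -> bhol f a r M -> c != 0 ->
  lcoef f a (c *: v) j = c ^+ j *: lcoef f a v j.
Proof.
move=> r0 fb c0.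
have := has_exp_uniq (lcoef_has_exp (c *: v) r0 fb)
  (has_exp_near ltr01 _ (has_exp_rescale c0 (lcoef_has_exp v r0 fb))).
move=> /(_ _)/(congr1 (fun b => b j)); apply => t _.
by rewrite scalerA mulrC.
Qed.

Lemma lcoef_sum f a (r M : R) v : 0 < r -> bhol f a r M -> nm v < r / 16 ->
  tends (fun n => \sum_(0 <= j < n) lcoef f a v j) (f (a + v)).
Proof.
(* Any positive c with |v| <= c < r/16 serves: the restriction to the line is then holomorphic on
   radius r/c > 16, which puts t = 1 in the range of [Dq_sum]. *)
move=> r0 fb vr; pose c := (r / 16 + nm v) / 2.
have nv := nm_ge0 v.
have c0 : 0 < c by rewrite /c; lra.
have := @Dq_sum R F (fun t : C^o => f (a + (t : C) *: v)) (r / c) M 1.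
rewrite nm1 divr_gt0 // scale1r => T.
have -> : (fun n => \sum_(0 <= j < n) lcoef f a v j) =
   (fun n => \sum_(0 <= j < n) (1 : C) ^+ j *: lcoef f a v j).
  by apply/funext => n; apply: eq_bigr => i _; rewrite expr1n scale1r.
apply: T => //.
  apply: (bhol_line r0 fb); rewrite mulrAC ler_pdivrMr //.
  by apply: ler_wpM2l; [exact: (ltW r0)|rewrite /c; lra].
by rewrite mulrAC ltr_pdivlMr // mul1r ltr_pdivlMr //; rewrite /c; lra.
Qed.

End LineCoefficients.

(** * Uniform bounds *)

Section UniformBounds.
Variables (R : realType) (F : normedModType R[i]).
Local Notation C := R[i].

(* Gliding hump: were [L j] the first unbounded map, a suitable bounded sequence
   would make the convolution sums grow faster than any exponential. *)
Lemma convolution_bounded (E : normedModType R[i]) (L : nat -> E -> F) (s : C) :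
  s != 0 -> nm s <= 1 -> (forall j, linear (L j)) ->
  (forall x : nat -> E, (forall n, nm (x n) <= 1) -> exists2 A : R, 0 <= A &
    forall k, nm (\sum_(0 <= n < k.+1) s ^+ n *: L (k - n)%N (x n)) <= A ^+ k.+1) ->
  forall j, exists2 B : R, 0 <= B & forall x, nm (L j x) <= B * nm x.
Proof.
move=> s0 s1 Llin conv; elim/ltn_ind => j IH; apply: contrapT => unb.
have /choice[Bf BfP] : forall i, exists B : R, (i < j)%N ->
    0 <= B /\ forall x, nm (L i x) <= B * nm x.
  by move=> i; have [/IH[B B0 BP]|_] := ltnP i j; [exists B|exists 0].
have big (B : R) : exists x, nm x <= 1 /\ B < nm (L j x).
  apply: contrapT => nb; apply: unb; exists `|B| => // x.
  have [->|x0] := eqVneq x 0.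
    have := Llin j (-1) 0 0; rewrite scaleN1r oppr0 addr0 scaleN1r addNr => ->.
    by rewrite !nm0 mulr0.
  have [u1 xE] := unit_dir x0; set u := _ *: x in u1 xE.
  have LZ c y : L j (c *: y) = c *: L j y.
    have := Llin j c y 0; rewrite addr0 => ->.
    have := Llin j (-1) 0 0; rewrite scaleN1r oppr0 addr0 scaleN1r addNr => ->.
    by rewrite addr0.
  rewrite {1}xE LZ nmZ nmR ger0_norm ?nm_ge0 // mulrC ler_wpM2r ?nm_ge0 //.
  apply: le_trans (ler_norm B); rewrite leNgt; apply/negP => Bu.
  by apply: nb; exists u.
(* In the sum of order k + j, the term n = k is s^k L_j(x_k). Earlier terms, collected in [rest],
   depend on x_0, ..., x_(k-1) only; later ones involve L_i with i < j and amount to at most [S].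
   Beating [target] makes the middle term exceed both by (k+j+1)^(k+j+1). *)
pose S := \sum_(0 <= i < j) Bf (j.-1 - i)%N.
pose rest (x : nat -> E) k := nm (\sum_(0 <= n < k) s ^+ n *: L (k + j - n)%N (x n)).
pose target x k := ((k + j).+1%:R ^+ (k + j).+1 + rest x k + S) / nm s ^+ k.
have /choice[g gP] : forall p : (nat -> E) * nat, exists x,
    nm x <= 1 /\ target p.1 p.2 < nm (L j x) by move=> p; exact: big.
(* [hist k] records x_0, ..., x_(k-1) and is 0 beyond, so that a single choice function on pairs
   (history, length) performs the recursive choice. *)
pose hist := fix hist k : nat -> E :=
  if k is n.+1 then fun i => if i == n then g (hist n, n) else hist n i else fun=> 0.
pose x n := g (hist n, n).
have histE k i : (i < k)%N -> hist k i = x i.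
  elim: k => // k IHk; rewrite ltnS leq_eqVlt /= => /orP[/eqP ->|ik].
    by rewrite eqxx.
  by rewrite ltn_eqF // IHk.
have x1 n : nm (x n) <= 1 by have [] := gP (hist n, n).
have [A A0 AP] := conv x x1.
have [k Ak] : exists k, A < k%:R by exists (Num.truncn A).+1; rewrite truncnS_gt.
have ns : 0 < nm s ^+ k by rewrite exprn_gt0 // nm_gt0.
have xk : target x k < nm (L j (x k)).
  have [_] := gP (hist k, k); rewrite /target /rest /= -/(x k); congr (_ < _).
  congr ((_ + nm _ + _) / _); apply: eq_big_nat => n /andP[_ nk].
  by rewrite histE.
rewrite ltr_pdivrMr // in xk.
have := AP (k + j)%N.
rewrite (@big_cat_nat _ _ _ k) //=; last by rewrite leqW // leq_addr.
rewrite (@big_ltn _ _ _ k) ?ltnS ?leq_addr // addKn.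
set Z := \sum_(k.+1 <= n < _) _ => total.
have ZS : nm Z <= S.
  rewrite /Z -{1}[k.+1]add0n big_addn subSS addKn; apply: le_trans (nm_sum _ _) _.
  rewrite /S big_nat_cond [leRHS]big_nat_cond; apply: ler_sum => i; rewrite andbT => /andP[_ ij].
  have -> : (k + j - (i + k.+1))%N = (j.-1 - i)%N by lia.
  have ij' : (j.-1 - i < j)%N by lia.
  have [B0 BP] := BfP _ ij'.
  rewrite nmZ nmX; apply: le_trans (_ : 1 * (Bf (j.-1 - i)%N * 1) <= _); last by rewrite mul1r mulr1.
  apply: ler_pM; rewrite ?exprn_ge0 ?nm_ge0 //; first by rewrite exprn_ile1 ?nm_ge0.
  by apply: le_trans (BP _) _; rewrite ler_wpM2l.
have Ak2 : A ^+ (k + j).+1 <= (k + j).+1%:R ^+ (k + j).+1.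
  rewrite lerXn2r ?nnegrE //; apply/ltW/(lt_le_trans Ak); rewrite ler_nat; lia.
move: xk; rewrite /rest mulrC -nmX -nmZ => xk.
move: total xk ZS; rewrite /rest.
set P := \sum_(0 <= n < k) _; set Q := s ^+ k *: _ => total xk ZS.
have : nm Q <= nm (P + (Q + Z)) + (nm P + nm Z).
  have {1}-> : Q = (P + (Q + Z)) - (P + Z) by mod_eq R[i].
  by apply: le_trans (nmB _ _) _; rewrite lerD2l nmD.
by lra.
Qed.

End UniformBounds.

(** * Baire's theorem for sequentially closed sets *)

Section Baire.
Variables (R : realType) (E : completeNormedModType R[i]).

(** If no [Cl n] contained a ball, each ball would contain a closed ball of at most half the radius
    missing the next set; the centres converge to a point lying in none of them. *)
Lemma baire_cover (Cl : nat -> E -> Prop) :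
  (forall n u l, (forall k, Cl n (u k)) -> tends u l -> Cl n l) ->
  (forall x, exists n, Cl n x) ->
  exists n a (r : R), 0 < r /\ forall x, nm (x - a) < r -> Cl n x.
Proof.
move=> closed cover; apply: contrapT => none.
have step (p : nat * (E * R)) : exists q : E * R, 0 < p.2.2 ->
    [/\ 0 < q.2, q.2 <= p.2.2 / 2, nm (q.1 - p.2.1) <= p.2.2 / 2 &
        forall y, nm (y - q.1) <= q.2 -> ~ Cl p.1 y].
  case: p => n [a r] /=; have [r0|_] := ltP 0 r; last by exists (a, r).
  have [x [xa nCl]] : exists x, nm (x - a) < r / 2 /\ ~ Cl n x.
    apply: contrapT => nx; apply: none; exists n, a, (r / 2); split; first by rewrite divr_gt0.
    by move=> x xa; apply: contrapT => nCl; apply: nx; exists x.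
  have [d [d0 dP]] : exists d : R, 0 < d /\ forall y, nm (y - x) <= d -> ~ Cl n y.
    apply: contrapT => nd; apply: nCl.
    have /choice[u uP] : forall k, exists y, nm (y - x) <= 2^-1 ^+ k /\ Cl n y.
      move=> k; apply: contrapT => ny; apply: nd; exists (2^-1 ^+ k).
      split; first by rewrite exprn_gt0 // invr_gt0.
      by move=> y yx Cly; apply: ny; exists y.
    apply: (closed n u) => [k|]; first by have [] := uP k.
    by apply: (tends_small (c := 1)) => // k; rewrite mul1r; have [] := uP k.
  exists (x, Num.min d (r / 2)) => _ /=; split; rewrite ?lt_min ?ge_min ?lexx ?orbT ?d0 ?divr_gt0 ?(ltW xa) //.
  by move=> y; rewrite le_min => /andP[/dP].
have {step}/choice[g gP] := step.
pose s := fix s n : E * R := if n is k.+1 then g (k, s k) else (0, 1).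
have s0 n : 0 < (s n).2.
  by elim: n => [|n IH] /=; [exact: ltr01|have [] := gP (n, s n) IH].
have sP n := gP (n, s n) (s0 n).
have s2 n : (s n).2 <= 2^-1 ^+ n.
  elim: n => [//|n IH]; have [_ h _ _] := sP n; apply: le_trans h _ => /=.
  by rewrite exprS; lra.
have [|l lP] := @tends_geometric R E (fun n => (s n).1) 1 ler01.
  by move=> n; have [_ _ h _] := sP n; rewrite mul1r; apply: le_trans h _; have := s2 n; have := s0 n => /=; lra.
have near n k : nm ((s (n + k)%N).1 - (s n).1) + (s (n + k)%N).2 <= (s n).2.
  elim: k => [|k IH]; first by rewrite addn0 subrr nm0 add0r.
  have [_ h1 h2 _] := sP (n + k)%N; rewrite /= in h1 h2; rewrite addnS /=.
  have := nmD ((g ((n + k)%N, s (n + k)%N)).1 - (s (n + k)%N).1) ((s (n + k)%N).1 - (s n).1).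
  by rewrite addrA subrK; lra.
have [n Cn] := cover l; have [_ _ _] := sP n => /(_ l _ Cn); apply.
have -> : g (n, s n) = s n.+1 by [].
rewrite /=; apply: (tends_le (u := fun k => (s (n.+1 + k)%N).1 - (s n.+1).1)).
  apply: tendsB (tends_cst _) => e /lP[n0 nP]; exists n0 => k n0k; apply: nP.
  by rewrite (leq_trans n0k) // leq_addl.
by move=> k; have := near n.+1 k; have := s0 (n.+1 + k)%N; lra.
Qed.

End Baire.

(** * From pointwise to operator-norm holomorphy *)

Section StrongHolomorphic.
Variables (R : realType) (V E F : normedModType R[i]).
Local Notation C := R[i].

Lemma chom_intro (f : E -> F) (B : R) : linear f ->
  (forall x, nm (f x) <= B * nm x) -> exists phi : CHom E F, forall x, phi x = f x.
Proof.
move=> lf fB.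
pose M := GRing.isLinear.Build R[i] E F _ f lf.
pose f' : {linear E -> F} := HB.pack f M.
have cf : continuous f'.
  apply/linear_bounded_continuous/linear_boundedP.
  exists (B%:C); split; first by rewrite realE !lecR -realE num_real.
  move=> y By x; apply: le_trans (_ : B%:C * `|x| <= _); first by rewrite -nm_leM.
  by rewrite ler_wpM2r // ltW.
have fc : f \in @clinear R E F by apply/clinearP.
by exists (MkCHom fc).
Qed.

Lemma nm_chom_le (phi : CHom E F) (B : R) : 0 <= B ->
  (forall x, nm (phi x) <= B * nm x) -> nm phi <= B.
Proof.
move=> B0 pB; rewrite -lecR -nmE chom_normE; apply: opnorm_le; first by rewrite lecR.
by move=> x; rewrite -nm_leM.
Qed.

Lemma dd_lin (f g : V -> F) (k : C) b : differentiable f b -> differentiable g b ->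
  dd (fun z => k *: f z + g z) b = (fun h => k *: dd f b h + dd g b h).
Proof.
move=> df dg; have [Kf Kf0 KfP] := diff_bounded df; have [Kg Kg0 KgP] := diff_bounded dg.
have nk := nm_ge0 k.
apply: (@diff_intro R V F _ b _ (nm k * Kf + Kg) _ _ _).2.
- move=> c x y; rewrite !dd_linear.
  move: (dd f b x) (dd f b y) (dd g b x) (dd g b y) => A B D G.
  by mod_eq R[i].
- move=> h; apply: le_trans (nmD _ _) _; rewrite mulrDl lerD // nmZ -mulrA ler_wpM2l //.
move=> e e0.
have [d1 d10 P1] := diff_approx df (e := e / 2 / (nm k + 1)) ltac:(by rewrite !divr_gt0 // ltr_wpDl).
have [d2 d20 P2] := diff_approx dg (e := e / 2) ltac:(by rewrite divr_gt0).
exists (Num.min d1 d2) => [|h]; first by rewrite lt_min d10.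
rewrite lt_min => /andP[/P1 p1 /P2 p2].
have -> : k *: f (b + h) + g (b + h) - (k *: f b + g b) - (k *: dd f b h + dd g b h) =
  k *: (f (b + h) - f b - dd f b h) + (g (b + h) - g b - dd g b h).
  move: (f (b + h)) (f b) (dd f b h) (g (b + h)) (g b) (dd g b h) => A B D A' B' D'.
  by mod_eq R[i].
apply: le_trans (nmD _ _) _; rewrite nmZ.
have : nm k * nm (f (b + h) - f b - dd f b h) <= e / 2 * nm h.
  apply: le_trans (ler_wpM2l nk p1) _.
  rewrite mulrA ler_wpM2r ?nm_ge0 // mulrA ler_pdivrMr ?ltr_wpDl //.
  by rewrite mulrDr mulr1 (mulrC (nm k)) lerDl divr_ge0 // ltW.
by lra.
Qed.

(** The pointwise bounds are proportional to |x|, hence so are the remainders of [taylor2]: they are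
    O(|h|^2) |x| with one constant, which is an operator-norm estimate. The derivative is assembled
    from the pointwise ones. *)
Theorem strong_holomorphic (Phi : V -> CHom E F) a (r M : R) : 0 <= M ->
  (forall x, bhol (fun z => Phi z x) a r (M * nm x)) ->
  forall z, nm (z - a) < r -> differentiable Phi z.
Proof.
move=> M0 Pb b ba; pose s := r - nm (b - a).
have s0 : 0 < s by rewrite subr_gt0.
have Pbb x : bhol (fun z => Phi z x) b s (M * nm x).
  by apply: bhol_sub (Pb x) _; rewrite /s; lra.
have dP x : differentiable (fun z => Phi z x) b.
  by have [] := Pbb x b; rewrite ?subrr ?nm0.
have ddB h x : nm (dd (fun z => Phi z x) b h) <= 4 * M / s * nm h * nm x.
  by have := dd_bound h s0 (Pbb x); congr (_ <= _); ring.
have /choice[L LP] : forall h, exists psi : CHom E F,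
    forall x, psi x = dd (fun z => Phi z x) b h.
  move=> h; apply: (@chom_intro _ (4 * M / s * nm h)); last exact: ddB.
  move=> k x y.
  have -> : (fun z => Phi z (k *: x + y)) = (fun z => k *: Phi z x + Phi z y).
    by apply/funext => z; exact: chom_linear.
  by rewrite (dd_lin k (dP x) (dP y)).
apply: (@diff_intro R V (CHom E F) Phi b L (4 * M / s) _ _ _).1.
- move=> k h h'; apply/val_inj/funext => x /=.
  rewrite -[RHS]/(k *: L h x + L h' x).
  by rewrite -[LHS]/(L (k *: h + h') x) !LP dd_linear.
- move=> h; apply: nm_chom_le => [|x]; last by rewrite LP.
  by rewrite mulr_ge0 ?nm_ge0 // divr_ge0 ?mulr_ge0 // ltW.
move=> e e0; pose K := 64 * M / s ^+ 2.
have K0 : 0 <= K by rewrite divr_ge0 ?mulr_ge0 ?exprn_ge0 // ltW.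
exists (Num.min (s / 4) (e / (K + 1))).
  by rewrite lt_min !divr_gt0 // ltr_wpDl.
move=> h; rewrite lt_min => /andP[hs]; rewrite ltr_pdivlMr ?ltr_wpDl // => hK.
have nh := nm_ge0 h.
apply: le_trans (_ : K * nm h ^+ 2 <= _); last by nra.
apply: nm_chom_le => [|x]; first by rewrite mulr_ge0 // exprn_ge0.
rewrite -[X in nm X]/(Phi (b + h) x - Phi b x - L h x) LP.
by have := taylor2 s0 (Pbb x) hs; congr (_ <= _); rewrite /K; ring.
Qed.

End StrongHolomorphic.

(** * Germs *)

Section Germs.
Variables (R : realType) (m : nat).
Local Notation C := R[i].
Local Notation V := 'rV[R[i]]_m.
Local Notation W := ('rV[R[i]]_m : normedModType R[i]).
Local Notation crd z i := ((z : V) 0 i).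
Variable zeta : W.

Lemma coord_le (v : W) i : nm (crd v i) <= nm v.
Proof.
apply/ler_addgt0Pr => e e0.
have : ball_ (fun x : W => `|x|) 0 (nm v + e)%:C v.
  by rewrite /ball_ /= sub0r normrN nmE ltcR ltrDl.
rewrite -(@mx_norm_ball _ 1 m) => -[_ /(_ 0 i)]; rewrite mxE -ball_normE /= sub0r normrN nmE ltcR.
by move=> /ltW.
Qed.

Lemma differentiable_coordB (i : 'I_m) (z : W) :
  differentiable (fun z : W => crd z i - crd zeta i : C^o) (z : W).
Proof.
apply: (@diff_intro R W C^o _ z (fun h => crd h i) 1 _ _ _).1.
- by move=> k x y; rewrite !mxE.
- by move=> h; rewrite mul1r coord_le.
move=> e e0; exists 1 => // h _; rewrite mxE.
have -> : crd z i + crd h i - crd zeta i - (crd z i - crd zeta i) - crd h i = 0 by ring.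
by rewrite nm0 mulr_ge0 ?nm_ge0 // ltW.
Qed.

Section OneGerm.
Variable F : completeNormedModType R[i].
Implicit Types (x y : germ zeta F) (v : W).

Lemma germ_bhol x : exists r M : R, 0 < r /\ bhol (repr x) zeta r M.
Proof.
have /near_nmP[r1 r10 P1] := holo_near (repr x).
have d0 : differentiable (repr x) zeta by apply: P1; rewrite subrr nm0.
have [r2 r20 P2] := diff_continuous_nm d0 (@ltr01 R).
exists (Num.min r1 r2), (1 + nm (repr x zeta)); split; first by rewrite lt_min r10.
move=> z; rewrite lt_min => /andP[/P1 dz /P2 nz]; split=> //.
by rewrite -(subrK (repr x zeta) (repr x z)); apply: le_trans (nmD _ _) _; rewrite lerD2r.
Qed.

Lemma bhol_germ (f : W -> F) (r M : R) : 0 < r -> bhol f zeta r M ->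
  exists x : germ zeta F, \forall z \near zeta, repr x z = f z.
Proof.
move=> r0 fb; have fn : \forall z \near zeta, differentiable f z.
  by apply/near_nmP; exists r => // z /fb[].
by exists (germ_of (Holo fn)); exact: repr_germ_of.
Qed.

Definition gcoef x v j : F := lcoef (repr x) zeta v j.

Lemma gcoef_uniq x (g : W -> F) v b : (\forall z \near zeta, repr x z = g z) ->
  has_exp (fun t : C^o => g (zeta + (t : C) *: v)) b -> gcoef x v = b.
Proof.
move=> /near_nmP[d d0 dP] gb; have [r [M [r0 xb]]] := germ_bhol x.
apply: has_exp_uniq (lcoef_has_exp v r0 xb) _.
have v1 : 0 < nm v + 1 by rewrite ltr_wpDl ?nm_ge0.
apply: (@has_exp_near _ _ _ _ _ (d / (nm v + 1))) gb; first by rewrite divr_gt0.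
move=> t; rewrite ltr_pdivlMr // => td; rewrite dP // addrC addKr nmZ.
by have := nm_ge0 t; nra.
Qed.

Lemma gcoef_exp x v : has_exp (fun t : C^o => repr x (zeta + (t : C) *: v)) (gcoef x v).
Proof. by have [r [M [r0 xb]]] := germ_bhol x; exact: lcoef_has_exp r0 xb. Qed.

Lemma gcoefD x y v j : gcoef (x + y) v j = gcoef x v j + gcoef y v j.
Proof.
by rewrite (gcoef_uniq (germ_addE x y) (has_expD (gcoef_exp x v) (gcoef_exp y v))).
Qed.

Definition const_germ (c : F) : germ zeta F := germ_of (Holo (holo_cst_near zeta c)).

Lemma const_germE c : \forall z \near zeta, repr (const_germ c) z = c.
Proof. exact: repr_germ_of. Qed.

Lemma gcoef0 v j : gcoef 0 v j = 0.
Proof. by have := gcoefD 0 0 v j; rewrite addr0 => /(canLR (addrK _)); rewrite subrr. Qed.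

Lemma gcoef_zero x : (forall v j, gcoef x v j = 0) -> x = 0.
Proof.
move=> x0; have [r [M [r0 xb]]] := germ_bhol x.
have nr : \forall z \near zeta, nm (z - zeta) < r / 16.
  by apply/near_nmP; exists (r / 16); first by rewrite divr_gt0.
apply: germ_eqP; apply: filterS2 nr (@germ0E R W zeta F) => z zr ->.
have := lcoef_sum r0 xb zr; rewrite (addrC zeta) subrK => T.
apply: tends_uniq T _; rewrite (_ : (fun n => _) = fun=> 0); first exact: tends_cst.
by apply/funext => n; rewrite big1 // => i _; exact: x0.
Qed.

Lemma gcoef_homog x (c : C) v j : c != 0 -> gcoef x (c *: v) j = c ^+ j *: gcoef x v j.
Proof. by move=> c0; have [r [M [r0 xb]]] := germ_bhol x; exact: lcoef_homog r0 xb c0. Qed.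

(** Merging M and 8/r into one base leaves a single parameter, the form used both by the gliding
    hump and by the countable cover for Baire's theorem. *)
Lemma gcoef_growth x : exists2 A : R, 0 <= A &
  forall v k, nm v <= 1 -> nm (gcoef x v k) <= A ^+ k.+1.
Proof.
have [r [M [r0 xb]]] := germ_bhol x; have M0 := bhol_ge0 r0 xb.
have r8 : 0 <= 8 / r by rewrite divr_ge0 // ltW.
exists (M + 8 / r); first by rewrite addr_ge0.
move=> v k v1; apply: le_trans (lcoef_bound k r0 xb v1) _.
rewrite exprS; apply: ler_pM => //; first exact: exprn_ge0.
  by rewrite lerDl.
by rewrite lerXn2r ?nnegrE ?addr_ge0 // lerDr.
Qed.

Definition coord_germ (i : 'I_m) : germ zeta C^o :=
  germ_of (Holo (nearW _ (differentiable_coordB i))).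

Lemma coord_scaleE i y : \forall z \near zeta,
  repr (coord_germ i *: y) z = (crd z i - crd zeta i : C) *: repr y z.
Proof.
have e1 : \forall z \near zeta, repr (coord_germ i) z = crd z i - crd zeta i.
  exact: repr_germ_of.
by apply: filterS2 (germ_scaleE (coord_germ i) y) e1 => z -> ->.
Qed.

Lemma gcoef_coord i y v j : gcoef (coord_germ i *: y) v j =
  if j is k.+1 then crd v i *: gcoef y v k else 0.
Proof.
have e := has_exp_shift (has_expZ (crd v i) (gcoef_exp y v)).
rewrite (gcoef_uniq (coord_scaleE i y) (b := fun j => if j is k.+1 then crd v i *: gcoef y v k else 0)) //.
apply: has_exp_near ltr01 _ e => t _.
by rewrite !mxE scalerA; congr (_ *: _); ring.
Qed.

Lemma tends_shift (u : nat -> F) l : tends u l -> tends (fun n => u n.+1) l.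
Proof. by move=> ul e /ul[n0 P]; exists n0 => n n0n; apply: P; exact: leqW. Qed.

Definition is_series i (x : nat -> F) (e : germ zeta F) := \forall z \near zeta,
  tends (fun n => \sum_(0 <= j < n) (crd z i - crd zeta i) ^+ j *: x j) (repr e z).

Lemma series_germ i (x : nat -> F) : (forall n, nm (x n) <= 1) -> exists e, is_series i x e.
Proof.
move=> x1; pose S n z := \sum_(0 <= j < n) (crd z i - crd zeta i : C) ^+ j *: x j.
have r0 : 0 < (1 / 2 : R) by rewrite divr_gt0.
have small (z : W) j : nm (z - zeta) < 1 / 2 ->
    nm ((crd z i - crd zeta i : C) ^+ j *: x j) <= 2^-1 ^+ j.
  move=> zr; have c := coord_le (z - zeta) i; rewrite !mxE in c.
  rewrite nmZ nmX -[leRHS]mulr1; apply: ler_pM; rewrite ?exprn_ge0 ?nm_ge0 //.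
  rewrite lerXn2r ?nnegrE ?nm_ge0 ?invr_ge0 //; apply: le_trans c _.
  by rewrite mul1r in zr; exact: ltW.
have Slim z : exists l, nm (z - zeta) < 1 / 2 -> tends (S^~ z) l.
  have [zr|zr] := pselect (nm (z - zeta) < 1 / 2); last by exists 0.
  have [|l lP] := @tends_geometric R F (S^~ z) 1 ler01; last by exists l.
  move=> n; rewrite mul1r /S big_nat_recr //=.
  by rewrite (addrC (\sum_(0 <= j < n) _)) addrK; exact: small.
have /choice[f fP] := Slim.
have fb : bhol f zeta (1 / 2) 2.
  apply: (@bhol_tends _ _ _ S) => // n z zr; split.
    apply: differentiable_sum_nat => j _.
    apply: (differentiable_scale (k := fun z : W => (crd z i - crd zeta i : C) ^+ j)).
      have dz := differentiable_coordB i z.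
      elim: j => [|j IH]; first by under eq_fun do rewrite expr0; exact: differentiable_cst.
      under eq_fun do rewrite exprS.
      exact: (differentiable_scale dz IH).
    exact: differentiable_cst.
  suff : nm (S n z) <= 2 * (1 - 2^-1 ^+ n).
    move=> /le_trans; apply; have : (0 : R) <= 2^-1 ^+ n by rewrite exprn_ge0 // invr_ge0.
    by lra.
  elim: n => [|n IH]; first by rewrite /S big_nil nm0 expr0 subrr mulr0.
  rewrite /S big_nat_recr //=; apply: le_trans (nmD _ _) _.
  by apply: le_trans (lerD IH (small z n zr)) _; rewrite exprS; lra.
have [e eP] := bhol_germ r0 fb; exists e; have : \forall z \near zeta, nm (z - zeta) < 1 / 2.
  by apply/near_nmP; exists (1 / 2).
by apply: filterS2 eP => z -> zr; exact: fP.
Qed.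

(** A finite algebraic identity, and therefore one to which a module homomorphism without continuity
    can be applied. *)
Lemma series_decomp i (x : nat -> F) (e e' : germ zeta F) : is_series i x e -> is_series i (fun n => x n.+1) e' ->
  e = const_germ (x 0%N) + coord_germ i *: e'.
Proof.
move=> xe xe'; apply: germ_eqP; near=> z.
rewrite (near (germ_addE (const_germ (x 0%N)) (coord_germ i *: e')) z) //.
rewrite (near (const_germE (x 0%N)) z) // (near (coord_scaleE i e') z) //.
have T : tends (fun n => \sum_(0 <= j < n) (crd z i - crd zeta i) ^+ j *: x j) (repr e z) by near: z.
have T' : tends (fun n => \sum_(0 <= j < n) (crd z i - crd zeta i) ^+ j *: x j.+1) (repr e' z) by near: z.
apply: tends_uniq (tends_shift T) _.
rewrite (_ : (fun n => _) = fun n => x 0%N + (crd z i - crd zeta i) *: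
    \sum_(0 <= j < n) (crd z i - crd zeta i) ^+ j *: x j.+1).
  by apply: tendsD; [exact: tends_cst|exact: tendsZ].
apply/funext => n; rewrite big_nat_recl // expr0 scale1r; congr (_ + _).
by rewrite scaler_sumr; apply: eq_bigr => j _; rewrite exprS scalerA.
Unshelve. all: by end_near. Qed.

Lemma repr_germ_sum (I : Type) (s : seq I) (y : I -> germ zeta F) :
  \forall z \near zeta, repr (\sum_(i <- s) y i) z = \sum_(i <- s) repr (y i) z.
Proof.
elim: s => [|i s IH].
  by rewrite big_nil; apply: filterS (@germ0E R W zeta F) => z ->; rewrite big_nil.
rewrite big_cons; apply: filterS2 (germ_addE (y i) (\sum_(j <- s) y j)) IH => z -> ->.
by rewrite big_cons.
Qed.

(** The quotient [G] of [hadamard] is linear in its first argument, so z - zeta may be expanded in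
    the standard basis. *)
Lemma germ_hadamard x : exists (c : F) (g : 'I_m -> germ zeta F),
  x = const_germ c + \sum_i coord_germ i *: g i.
Proof.
have [r [M [r0 xb]]] := germ_bhol x.
have [G [Gb Glin GE]] := hadamard r0 xb.
have r8 : 0 < r / 8 by rewrite divr_gt0.
have /choice[g gP] : forall i : 'I_m, exists y : germ zeta F,
    \forall z \near zeta, repr y z = G (delta_mx 0 i) z.
  by move=> i; exact: bhol_germ r8 (Gb _).
exists (repr x zeta), g; apply: germ_eqP.
have nr : \forall z \near zeta, nm (z - zeta) < r / 8 by apply/near_nmP; exists (r / 8).
have gn (s : seq 'I_m) : \forall z \near zeta,
    \sum_(i <- s) repr (coord_germ i *: g i) z =
    \sum_(i <- s) (crd z i - crd zeta i : C) *: G (delta_mx 0 i) z.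
  elim: s => [|i s IH]; first by apply/near_nmP; exists 1 => // z _; rewrite !big_nil.
  apply: filterS3 (coord_scaleE i (g i)) (gP i) IH => z e1 e2 e3.
  by rewrite !big_cons e1 e2 e3.
near=> z.
have zr : nm (z - zeta) < r / 8 by near: z.
rewrite (near (germ_addE (const_germ (repr x zeta)) (\sum_i coord_germ i *: g i)) z) //.
rewrite (near (const_germE (repr x zeta)) z) //.
rewrite (near (repr_germ_sum (index_enum 'I_m) (fun i => coord_germ i *: g i)) z) //.
rewrite (GE z zr); congr (_ + _).
rewrite (near (gn (index_enum 'I_m)) z) //.
have G0 : G 0 z = 0.
  by have := Glin z (-1) 0 0 zr; rewrite scaleN1r oppr0 addr0 scaleN1r addNr.
rewrite {1}[z - zeta]row_sum_delta.
elim: (index_enum _) => [|i s IH]; first by rewrite !big_nil.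
by rewrite !big_cons Glin // IH !mxE.
Unshelve. all: by end_near. Qed.

End OneGerm.
End Germs.

(** * Homomorphisms of germs *)

Section Homomorphism.
Variables (R : realType) (m : nat).
Local Notation C := R[i].
Local Notation V := 'rV[R[i]]_m.
Local Notation W := ('rV[R[i]]_m : normedModType R[i]).
Variables (zeta : W) (E F : completeNormedModType R[i]).
Implicit Types (v w z : W) (x y : E).

(** [T] is linear over the ring of germs; complex scalars enter through constant germs. *)
Definition scalar_germ (c : C) : germ zeta C^o :=
  germ_of (Holo (holo_cst_near zeta (c : C^o))).

Lemma scalar_scaleE (G : completeNormedModType R[i]) (c : C) (y : germ zeta G) :
  \forall z \near zeta, repr (scalar_germ c *: y) z = c *: repr y z.
Proof.
have e1 : \forall z \near zeta, repr (scalar_germ c) z = c by exact: repr_germ_of.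
by apply: filterS2 (germ_scaleE (scalar_germ c) y) e1 => z -> ->.
Qed.

Lemma gcoef_scalar (c : C) (y : germ zeta F) v j :
  gcoef (scalar_germ c *: y) v j = c *: gcoef y v j.
Proof. by rewrite (gcoef_uniq (scalar_scaleE c y) (has_expZ c (gcoef_exp y v))). Qed.

Lemma const_germ_linear (c : C) x y : const_germ zeta (c *: x + y) =
  scalar_germ c *: const_germ zeta x + const_germ zeta y.
Proof.
apply: germ_eqP; near=> z.
rewrite (near (const_germE zeta (c *: x + y)) z) //.
rewrite (near (germ_addE (scalar_germ c *: const_germ zeta x) (const_germ zeta y)) z) //.
rewrite (near (scalar_scaleE c (const_germ zeta x)) z) //.
by rewrite (near (const_germE zeta x) z) // (near (const_germE zeta y) z).
Unshelve. all: by end_near. Qed.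

Variable T : {linear germ zeta E -> germ zeta F}.

Definition tcoef v j x : F := gcoef (T (const_germ zeta x)) v j.

Lemma tcoef_linear v j : linear (tcoef v j).
Proof.
move=> c x y; rewrite /tcoef const_germ_linear.
by rewrite (linearP T) gcoefD gcoef_scalar.
Qed.

Lemma tcoefB v j x y : tcoef v j (x - y) = tcoef v j x - tcoef v j y.
Proof.
have := tcoef_linear v j (-1) y x; rewrite !scaleN1r => H.
by rewrite (addrC x) H addrC.
Qed.

(** Peeling off one term shifts the order by one: the k-th coefficient of (z_i - zeta_i) T e' is v_i
    times the (k-1)-st of T e', and that of order 0 vanishes. So the unknown tail disappears after k
    + 1 steps. *)
Lemma series_gcoef i v (x : nat -> E) e : (forall n, nm (x n) <= 1) -> is_series i x e ->
  forall k, gcoef (T e) v k =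
    \sum_(0 <= n < k.+1) (v : V) 0 i ^+ n *: tcoef v (k - n)%N (x n).
Proof.
move=> x1 xe k; elim: k x e x1 xe => [|k IH] x e x1 xe;
  have [e' xe'] := @series_germ R m zeta E i (fun n => x n.+1) (fun n => x1 n.+1);
  rewrite (series_decomp xe xe') addrC linearP gcoefD gcoef_coord.
  by rewrite add0r big_nat1 expr0 scale1r.
rewrite (IH _ e' (fun n => x1 n.+1) xe') [RHS]big_nat_recl // expr0 scale1r subn0 [RHS]addrC.
congr (_ + _); rewrite scaler_sumr; apply: eq_bigr => n _.
by rewrite scalerA -exprS subSS.
Qed.

Lemma tcoef_bounded_dir v j : v != 0 -> nm v <= 1 ->
  exists2 B : R, 0 <= B & forall x, nm (tcoef v j x) <= B * nm x.
Proof.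
move=> v0 v1; have /rV0Pn[i vi] : (v : V) != 0 by [].
apply: (convolution_bounded vi) => [|j'|x x1].
- exact: le_trans (coord_le v i) v1.
- exact: tcoef_linear.
have [e xe] := @series_germ R m zeta E i x x1.
have [A A0 AP] := gcoef_growth (T e); exists A => // k.
by rewrite -(series_gcoef v x1 xe k); exact: AP.
Qed.

(** At order 0 the coefficient is the value at zeta, common to all directions. At positive order,
    doubling the zero vector multiplies it by 2^j and leaves it unchanged. *)
Lemma tcoef_zero_dir v j x : tcoef 0 j x = if j is 0%N then tcoef v 0 x else 0.
Proof.
case: j => [|j]; first by rewrite /tcoef /gcoef /lcoef /Dq /= !scale0r.
have two : (2 : C) != 0 by rewrite pnatr_eq0.
have := gcoef_homog (T (const_germ zeta x)) 0 j.+1 two; rewrite scaler0 -/(tcoef 0 j.+1 x).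
move=> /eqP; rewrite -subr_eq0 -{1}[tcoef _ _ _]scale1r -scalerBl scaler_eq0 subr_eq0.
case/orP => [|/eqP //]; rewrite eq_sym -natrX pnatr_eq1.
by rewrite -[X in _ == X](expn0 2) eqn_exp2l.
Qed.

Lemma tcoef_bounded v j : (0 < m)%N -> nm v <= 1 ->
  exists2 B : R, 0 <= B & forall x, nm (tcoef v j x) <= B * nm x.
Proof.
move=> m0 v1; have [->|v0] := eqVneq v 0; last exact: tcoef_bounded_dir.
(* The zero direction borrows its bound from a nonzero one, which exists because m > 0. *)
pose c : W := const_mx 1.
have c0 : c != 0.
  by apply/eqP => /matrixP /(_ 0 (Ordinal m0)); rewrite !mxE => /eqP; rewrite oner_eq0.
have [u1 cE] := unit_dir c0; set u := _ *: c in u1 cE.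
have u0 : u != 0 by apply: contra_neq c0 => u0; rewrite cE u0 scaler0.
have [B B0 BP] := tcoef_bounded_dir 0 u0 u1.
exists B => // x; rewrite (tcoef_zero_dir u); case: j => [|j]; first exact: BP.
by rewrite nm0 mulr_ge0 ?nm_ge0.
Qed.

Lemma tcoef_uniform : (0 < m)%N -> exists (K : R) (N : nat), 0 <= K /\
  forall v j x, nm v <= 1 -> nm (tcoef v j x) <= K * N.+1%:R ^+ j * nm x.
Proof.
move=> m0.
(* All orders and all directions enter one set, so the ball found serves them uniformly. *)
pose Cl N x := forall j v, nm v <= 1 -> nm (tcoef v j x) <= N.+1%:R ^+ j.+1.
have [N u l uN ul|x|N [a [r [r0 aP]]]] := @baire_cover R E Cl.
- move=> j v v1; have [B B0 BP] := tcoef_bounded j m0 v1.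
  apply: (tends_le (u := fun n => tcoef v j (u n))) => [|n]; last exact: uN.
  move=> e e0; have [n0 nP] := ul (e / (B + 1)) ltac:(by rewrite divr_gt0 // ltr_wpDl).
  exists n0 => n /nP; rewrite ler_pdivlMr ?ltr_wpDl // => un.
  have -> : tcoef v j (u n) - tcoef v j l = tcoef v j (u n - l).
    by rewrite tcoefB.
  by have := BP (u n - l); have := nm_ge0 (u n - l); nra.
- have [A A0 AP] := gcoef_growth (T (const_germ zeta x)).
  exists (Num.truncn A) => j v v1; apply: le_trans (AP v j v1) _.
  by rewrite lerXn2r ?nnegrE // ltW // truncnS_gt.
(* A vector y of norm at most r/2 is the difference of y + a and a, which gives 2 (N+1)^(j+1);
   rescaling to x costs 2/r, and one factor N+1 moves into the constant. *)
exists (4 * N.+1%:R / r), N; split; first by rewrite divr_ge0 ?mulr_ge0 // ltW.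
move=> v j x v1; have [->|x0] := eqVneq x 0.
  by rewrite -(subrr (0 : E)) tcoefB !subrr !nm0 mulr0.
have [u1 xE] := unit_dir x0; set u := _ *: x in u1 xE.
pose y := (r / 2)%:C *: u.
have r2 : 0 < r / 2 by rewrite divr_gt0.
have ya : nm (y + a - a) < r.
  rewrite addrK nmZ nmR gtr0_norm //; have := ler_piMr (ltW r2) u1; lra.
have ty : tcoef v j y = tcoef v j (y + a) - tcoef v j a.
  by rewrite -tcoefB addrK.
have by1 := aP (y + a) ya j v v1.
have by2 := aP a ltac:(by rewrite subrr nm0) j v v1.
have by3 : nm (tcoef v j y) <= 2 * N.+1%:R ^+ j.+1.
  by rewrite ty; apply: le_trans (nmB _ _) _; lra.
have xy : x = (nm x * (2 / r))%:C *: y + 0.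
  rewrite addr0 /y scalerA -CM (_ : nm x * (2 / r) * (r / 2) = nm x) //.
  by field; rewrite gt_eqF.
have t0 : tcoef v j 0 = 0.
  by rewrite -(subrr (0 : E)) tcoefB subrr.
rewrite {1}xy tcoef_linear t0 addr0 nmZ nmR ger0_norm; last first.
  by rewrite mulr_ge0 ?nm_ge0 // divr_ge0 // ltW.
apply: le_trans (ler_wpM2l _ by3) _.
  by rewrite mulr_ge0 ?nm_ge0 // divr_ge0 // ltW.
by rewrite le_eqVlt; apply/orP; left; apply/eqP; rewrite exprS; ring.
Qed.

Lemma constants_plain : (0 < m)%N -> exists Phi : germ zeta (CHom E F),
  forall x, T (const_germ zeta x) = plain_map Phi (const_germ zeta x).
Proof.
move=> /tcoef_uniform[K [N [K0 KP]]].
(* On this radius the j-th term is at most K |x| 2^-j; moreover rho < 1 keeps z - zeta in the unit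
   ball, where [lcoef_bhol] applies. *)
pose rho : R := (2 * N.+1%:R)^-1.
have rho0 : 0 < rho by rewrite invr_gt0 mulr_gt0 // ltr0n.
have rho1 : rho < 1.
  by rewrite invf_lt1 ?mulr_gt0 ?ltr0n // -natrM ltr1n; lia.
have rhoN : rho * N.+1%:R = 2^-1.
  by rewrite /rho invfM -mulrA mulVf ?mulr1 // pnatr_eq0.
have rhoC : (rho%:C : C) != 0.
  by apply: contraTneq rho0 => E0; have := nmR rho; rewrite E0 nm0 => /esym/normr0_eq0 ->; rewrite ltxx.
have small w j x : nm w < rho -> nm (tcoef w j x) <= K * nm x * 2^-1 ^+ j.
  move=> wr; pose u : W := (rho^-1)%:C *: w.
  have u1 : nm u <= 1.
    by rewrite nmZ nmR ger0_norm ?invr_ge0 ?(ltW rho0) // mulrC ler_pdivrMr // mul1r ltW.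
  have wE : w = rho%:C *: u by rewrite scalerA -CM mulfV ?gt_eqF // rmorph1 scale1r.
  rewrite {1}wE /tcoef gcoef_homog // nmZ nmX nmR gtr0_norm // -/(tcoef u j x).
  apply: le_trans (ler_wpM2l _ (KP u j x u1)) _; first by rewrite exprn_ge0 // ltW.
  by rewrite -rhoN exprMn le_eqVlt; apply/orP; left; apply/eqP; ring.
pose S x n z := \sum_(0 <= j < n) tcoef (z - zeta) j x.
have f_ex (p : E * W) : exists l, nm (p.2 - zeta) < rho -> tends (fun n => S p.1 n p.2) l.
  have [zr|zr] := pselect (nm (p.2 - zeta) < rho); last by exists 0.
  have [||l lP] := @tends_geometric R F (fun n => S p.1 n p.2) (K * nm p.1); last by exists l.
    by rewrite mulr_ge0 ?nm_ge0.
  move=> n; rewrite /S big_nat_recr //= (addrC (\sum_(0 <= j < n) _)) addrK; exact: small.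
have {f_ex}/choice[f0 fP] := f_ex; pose f x z := f0 (x, z).
have fb x : bhol (f x) zeta rho (2 * K * nm x).
  apply: (@bhol_tends _ _ _ (S x)) => [n z zr|z zr]; last exact: (fP (x, z)).
  split.
    apply: differentiable_sum_nat => j _.
    have [r [M [r0 yb]]] := germ_bhol (T (const_germ zeta x)).
    have [|dl _] := lcoef_bhol j r0 yb (z := z - zeta).
      by rewrite subr0; apply: lt_trans zr rho1.
    have -> : (fun z : W => tcoef (z - zeta) j x) =
       (fun z : W => (fun v => lcoef (repr (T (const_germ zeta x))) zeta v j) (0 + 1 *: (z - zeta))).
      by apply/funext => w; rewrite add0r scale1r.
    apply: (@differentiable_affine R W F
      (fun v => lcoef (repr (T (const_germ zeta x))) zeta v j) 0 1 zeta z).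
    by rewrite add0r scale1r.
  suff : nm (S x n z) <= 2 * K * nm x * (1 - 2^-1 ^+ n).
    move=> /le_trans; apply; apply: ler_piMr.
      by apply: mulr_ge0; [exact: mulr_ge0|exact: nm_ge0].
    by rewrite lerBlDr lerDl exprn_ge0 // invr_ge0.
  elim: n => [|n IH]; first by rewrite /S big_nil nm0 expr0 subrr mulr0.
  rewrite /S big_nat_recr //=; apply: le_trans (nmD _ _) _.
  apply: le_trans (lerD IH (small _ n x zr)) _; rewrite exprS.
  by move: (nm x) (2^-1 ^+ n) => p q; lra.
have flin z c x y : nm (z - zeta) < rho -> f (c *: x + y) z = c *: f x z + f y z.
  move=> zr; apply: tends_uniq (fP (c *: x + y, z) zr) _.
  rewrite (_ : (fun n => _) = fun n => c *: S x n z + S y n z).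
    by apply: tendsD; [apply: tendsZ; exact: (fP (x, z))|exact: (fP (y, z))].
  apply/funext => n; rewrite /S scaler_sumr -big_split; apply: eq_bigr => j _.
  exact: tcoef_linear.
have Phi_ex z : exists phi : CHom E F, nm (z - zeta) < rho -> forall x, phi x = f x z.
  have [zr|zr] := pselect (nm (z - zeta) < rho); last by exists 0.
  have [|x|phi phiP] := @chom_intro R E F (fun x => f x z) (2 * K); last by exists phi.
    by move=> c x y; exact: flin.
  by have [] := fb x z zr.
have /choice[Phi PhiP] := Phi_ex.
have Phib x : bhol (fun z => Phi z x) zeta rho (2 * K * nm x).
  move=> z zr; have [df fM] := fb x z zr; split; last by rewrite PhiP.
  apply: (@differentiable_near _ _ _ (f x) _ z (rho - nm (z - zeta))) => //.
    by rewrite subr_gt0.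
  move=> w wz; rewrite PhiP // -(subrK z w) -addrA.
  by apply: le_lt_trans (nmD _ _) _; lra.
have Phid : \forall z \near zeta, differentiable Phi z.
  apply/near_nmP; exists rho => // z; apply: (strong_holomorphic _ Phib).
  by rewrite mulr_ge0.
exists (germ_of (Holo Phid)) => x; apply: germ_eqP.
(* The radius [r] depends on x, whereas [Phi] lives on the fixed ball of radius [rho]. This is
   harmless, because equality of germs is claimed for each x separately. *)
have [r [M [r0 yb]]] := germ_bhol (T (const_germ zeta x)).
have r16 : 0 < r / 16 by rewrite divr_gt0.
have nr : \forall z \near zeta, nm (z - zeta) < Num.min rho (r / 16).
  by apply/near_nmP; exists (Num.min rho (r / 16)) => //; rewrite lt_min rho0.
near=> z.
rewrite (near (plain_mapE (germ_of (Holo Phid)) (const_germ zeta x)) z) //.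
rewrite (near (repr_germ_of (Holo Phid)) z) // (near (const_germE zeta x) z) //=.
have : nm (z - zeta) < Num.min rho (r / 16) by near: z.
rewrite lt_min => /andP[zrho zr]; rewrite PhiP //.
have := lcoef_sum r0 yb zr; rewrite (addrC zeta) subrK => Tz.
exact: tends_uniq Tz (fP (x, z) zrho).
Unshelve. all: by end_near. Qed.

Lemma gcoef_sum (I : Type) (s : seq I) (y : I -> germ zeta F) v j :
  gcoef (\sum_(i <- s) y i) v j = \sum_(i <- s) gcoef (y i) v j.
Proof.
elim: s => [|i s IH]; first by rewrite !big_nil gcoef0.
by rewrite !big_cons gcoefD IH.
Qed.

(* Splitting off the value and dividing by the coordinates, a module map killing
   the constants raises the order of vanishing arbitrarily. *)
Lemma plain_of_constants (Phi : germ zeta (CHom E F)) :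
  (forall x, T (const_germ zeta x) = plain_map Phi (const_germ zeta x)) ->
  forall e, T e = plain_map Phi e.
Proof.
move=> TPhi e; apply/eqP; rewrite -subr_eq0; apply/eqP/gcoef_zero => v j.
pose M := GRing.isLinear.Build _ _ _ _ (plain_map Phi) (plain_map_linear Phi).
pose P : {linear germ zeta E -> germ zeta F} := HB.pack (plain_map Phi) M.
have split_map (Q : {linear germ zeta E -> germ zeta F}) c (g : 'I_m -> germ zeta E) :
    Q (const_germ zeta c + \sum_i coord_germ zeta i *: g i) =
    Q (const_germ zeta c) + \sum_i coord_germ zeta i *: Q (g i).
  rewrite linearD linear_sum /=; congr (_ + _).
  by apply: eq_bigr => i _; rewrite linearZ.
have diffE c (g : 'I_m -> germ zeta E) :
    T (const_germ zeta c + \sum_i coord_germ zeta i *: g i) -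
    P (const_germ zeta c + \sum_i coord_germ zeta i *: g i) =
    \sum_i coord_germ zeta i *: (T (g i) - P (g i)).
  rewrite !split_map TPhi opprD addrACA subrr add0r -sumrB.
  by apply: eq_bigr => i _; rewrite scalerBr.
rewrite -[plain_map Phi e]/(P e).
elim: j e => [|j IH] e; have [c [g ->]] := germ_hadamard e;
  rewrite diffE gcoef_sum big1 // => i _; rewrite gcoef_coord //.
by rewrite (IH (g i)) scaler0.
Qed.

End Homomorphism.

Unset Implicit Arguments.

Theorem theorem1p2 (R : realType) (m : nat) (m_gt0 : (0 < m)%N)
    (zeta : 'rV[R[i]]_m) (E F : completeNormedModType R[i])
    (T : {linear germ zeta E -> germ zeta F}) :
  exists Phi : germ zeta (CHom E F),
    forall e : germ zeta E, T e = plain_map Phi e.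
Proof.
have [Phi PhiP] := constants_plain T m_gt0.
by exists Phi; exact: plain_of_constants PhiP.
Qed.
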